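(* (Poincar\'e--Birkhoff--Witt theorem.) Let $\Psi=(B,d,h)$ be a Koszul CDG-algebra. Then there is an isomorphism of graded algebras $\mathrm{Gr}\,A(\Psi)\simeq B^!$, where $\mathrm{Gr}$ is the associated graded algebra with respect to the filtration $F_nA=W^n$ on $A=A(\Psi)$.
   Context: Conventions: $k$ is a fixed field; algebras are associative with unit $e$; graded algebras are locally finite-dimensional. $[a,b]=ab-(-1)^{\tilde a\tilde b}ba$ is the supercommutator. A derivation $d$ of degree $+1$ satisfies $d(ab)=d(a)b+(-1)^{\tilde a}a\,d(b)$. A quadratic algebra is a graded algebra of the form $B=T(U)/(R)$, $U$ in degree $1$, $R\subset U\otimes U$; its quadratic dual is $B^!=T(U^* )/(R^\perp)$, with $R^\perp\subset U^*\otimes U^*$ the annihilator of $R$ under $\langle\alpha\otimes\beta,u\otimes w\rangle=\alpha(u)\beta(w)$. A quadratic algebra $B$ is Koszul if the algebra $\mathrm{Ext}^*_B(k,k)$ is generated by $\mathrm{Ext}^1_B(k,k)$. CDG-algebra: a triple $\Psi=(B,d,h)$ with $B$ a graded algebra ($B^i=0$ for $i<0$), $d$ a derivation of $B$ of degree $+1$, $h\in B^2$, such that $d^2=[h,\cdot\,]$ and $d(h)=0$. It is quadratic (Koszul) if $B$ is a quadratic (Koszul) algebra. The algebra $A(\Psi)$ of a quadratic CDG-algebra: put $V=(B^1)^*$, and let $I=(B^2)^*\hookrightarrow V\otimes V$ be the dual of the surjective multiplication map $B^1\otimes B^1\to B^2$. Let $\varphi\colon I\to V$ be the dual of $d\colon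 B^1\to B^2$ and view $h\in B^2$ as a linear functional on $I$. Then $A(\Psi)$ is the quotient of the tensor algebra $T(V)$ by the two-sided ideal generated by the elements $p+\varphi(p)+h(p)$, $p\in I$. $W\subset A(\Psi)$ is the image of $k\oplus V$, and $F_nA=W^n$ ($F_0A=k\cdot e$). *)

(* Defs.v *)
From HB Require Import structures.
From mathcomp Require Import all_boot all_order all_algebra.
From mathcomp Require Import finmap boolp monalg.

Set Implicit Arguments.
Unset Strict Implicit.
Unset Printing Implicit Defensive.

Import GRing.Theory.
Local Open Scope ring_scope.
Local Open Scope quotient_scope.

Section Span.
Variables (k : fieldType) (M : lmodType k) (S : M -> Prop).

Inductive in_span : M -> Prop :=
| in_span0 : in_span 0
| in_spanD c s x : S s -> in_span x -> in_span (c *: s + x).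

Lemma in_span_lin c x y : in_span x -> in_span y -> in_span (c *: x + y).
Proof.
move=> xS yS; elim: xS => [|c' s x' Ss _ IH]; first by rewrite scaler0 add0r.
by rewrite scalerDr -addrA scalerA; constructor.
Qed.

Definition span_pred : {pred M} := fun x => `[< in_span x >].

Lemma span_submod : submod_closed span_pred.
Proof.
split=> [|c x y]; first by apply/asboolP; constructor.
by move=> /asboolP xS /asboolP yS; apply/asboolP/in_span_lin.
Qed.

HB.instance Definition _ := GRing.isSubmodClosed.Build k M span_pred span_submod.

Definition linspan : submodClosed M := span_pred.

Lemma mem_span x : S x -> x \in linspan.
Proof.
by move=> Sx; apply/asboolP; rewrite -[x]addr0 -[X in X + _]scale1r; constructor=> //; constructor.
Qed.
End Span.

Section SubSpace.
Variables (k : fieldType) (M : lmodType k) (X : submodClosed M).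

Record subspace := Subspace { subspace_val :> M; subspaceP : subspace_val \in X }.
HB.instance Definition _ := [isSub for subspace_val].
HB.instance Definition _ := [Choice of subspace by <:].
HB.instance Definition _ := [SubChoice_isSubLmodule of subspace by <:].

Lemma subspace_val_lin c (a b : subspace) :
  subspace_val (c *: a + b) = c *: subspace_val a + subspace_val b.
Proof. exact: (linearP (val : subspace -> M)). Qed.

Lemma subspace_inj (a b : subspace) : subspace_val a = subspace_val b -> a = b.
Proof. exact: val_inj. Qed.
End SubSpace.
Arguments Subspace {k M X} _ _.

Section QuotSpace.
Variables (k : fieldType) (M : lmodType k) (X : submodClosed M).

Definition zmod_pred : {pred M} := fun x => x \in X.

Lemma zmod_pred_closed : zmod_closed zmod_pred.
Proof. split=> [|x y xX yX]; first exact: (rpred0 X).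
by rewrite -scaleN1r; apply: (rpredD xX); apply: rpredZ. Qed.
HB.instance Definition _ := GRing.isZmodClosed.Build M zmod_pred zmod_pred_closed.

Definition zmodX : GRing.ZmodClosed.type M := (zmod_pred : {pred M}).
Definition quotspace := Quotient.quot zmodX.
HB.instance Definition _ := GRing.Zmodule.on quotspace.

Definition qproj (x : M) : quotspace := \pi_(Quotient.quot zmodX) x.
Definition qrepr (a : quotspace) : M := repr (a : Quotient.quot zmodX).

Lemma qprojP x y : reflect (qproj x = qproj y) (x - y \in X).
Proof. by rewrite -[_ \in X]/(x - y \in zmodX) Quotient.idealrBE; apply: eqP. Qed.

Lemma qreprK : cancel qrepr qproj.
Proof. exact: reprK. Qed.

Lemma qproj_zmod : zmod_morphism qproj.
Proof. exact: (raddfB (\pi_(Quotient.quot zmodX) : {additive _ -> _})). Qed.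
HB.instance Definition _ := GRing.isZmodMorphism.Build M quotspace qproj qproj_zmod.

Definition qscale (c : k) (a : quotspace) : quotspace := qproj (c *: qrepr a).

Lemma qscaleE c x : qscale c (qproj x) = qproj (c *: x).
Proof.
by apply/qprojP; rewrite -scalerBr rpredZ //; apply/qprojP; rewrite qreprK.
Qed.

Lemma qscaleA a b v : qscale a (qscale b v) = qscale (a * b) v.
Proof. by rewrite -[v]qreprK !qscaleE scalerA. Qed.
Lemma qscale1 : left_id 1 qscale.
Proof. by move=> v; rewrite -[v]qreprK qscaleE scale1r. Qed.
Lemma qscaleDr : right_distributive qscale +%R.
Proof.
by move=> c u v; rewrite -[u]qreprK -[v]qreprK -raddfD !qscaleE scalerDr raddfD.
Qed.
Lemma qscaleDl v : {morph qscale^~ v : a b / a + b}.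
Proof. by move=> a b; rewrite -[v]qreprK !qscaleE scalerDl raddfD. Qed.
HB.instance Definition _ :=
  GRing.Zmodule_isLmodule.Build k quotspace qscaleA qscale1 qscaleDr qscaleDl.

Lemma qproj_scalable : scalable qproj.
Proof. by move=> c x; rewrite -qscaleE. Qed.
HB.instance Definition _ := GRing.isScalable.Build k M quotspace _ qproj qproj_scalable.
End QuotSpace.

(* The quotient of an algebra by the two-sided ideal generated by S.  It may be
   zero, so it cannot be an [algType]: it is a [pzRingType] and an [lmodType]
   with [qscaleAl] and [qscaleAr]. *)

Section QuotAlg.
Variables (k : fieldType) (T : algType k) (S : T -> Prop).

Inductive in_ideal : T -> Prop :=
| in_ideal0 : in_ideal 0
| in_idealD a s b x : S s -> in_ideal x -> in_ideal (a * s * b + x).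

Definition ideal_pred : {pred T} := fun x => `[< in_ideal x >].

Lemma ideal_submod : submod_closed ideal_pred.
Proof.
split=> [|c x y]; first by apply/asboolP; constructor.
move=> /asboolP xI /asboolP yI; apply/asboolP.
elim: xI => [|a s b x' Ss _ IH]; first by rewrite scaler0 add0r.
by rewrite scalerDr -addrA 2!scalerAl; constructor.
Qed.
HB.instance Definition _ := GRing.isSubmodClosed.Build k T ideal_pred ideal_submod.

Lemma idealMl a x : x \in ideal_pred -> a * x \in ideal_pred.
Proof.
move=> /asboolP xI; apply/asboolP; elim: xI => [|b s c y Ss _ IH].
  by rewrite mulr0; constructor.
by rewrite mulrDr !mulrA; constructor.
Qed.

Lemma idealMr a x : x \in ideal_pred -> x * a \in ideal_pred.
Proof.
move=> /asboolP xI; apply/asboolP; elim: xI => [|b s c y Ss _ IH].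
  by rewrite mul0r; constructor.
by rewrite mulrDl -!mulrA mulrA; constructor.
Qed.

Definition ideal : submodClosed T := ideal_pred.

Definition quotalg := quotspace ideal.
HB.instance Definition _ := GRing.Lmodule.on quotalg.

Definition qpi (x : T) : quotalg := qproj ideal x.
Lemma qpi_zmod : zmod_morphism qpi. Proof. exact: qproj_zmod. Qed.
HB.instance Definition _ := GRing.isZmodMorphism.Build T quotalg qpi qpi_zmod.
Lemma qpi_scalable : scalable qpi. Proof. exact: qproj_scalable. Qed.
HB.instance Definition _ := GRing.isScalable.Build k T quotalg _ qpi qpi_scalable.

Lemma qpiP x y : reflect (qpi x = qpi y) (x - y \in ideal).
Proof. exact: qprojP. Qed.

Definition qone : quotalg := qpi 1.
Definition qmul (a b : quotalg) : quotalg := qpi (qrepr a * qrepr b).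

Lemma qpi_surj (a : quotalg) : exists x, a = qpi x.
Proof. by exists (qrepr a); rewrite /qpi qreprK. Qed.

Lemma qmulE x y : qmul (qpi x) (qpi y) = qpi (x * y).
Proof.
apply/qpiP.
rewrite -[_ * _](subrK (x * qrepr (qpi y))) -mulrBl -addrA -mulrBr rpredD //.
  by apply/idealMr/qpiP; rewrite /qpi qreprK.
by apply/idealMl/qpiP; rewrite /qpi qreprK.
Qed.

Lemma qmulA : associative qmul.
Proof.
move=> a b c; case: (qpi_surj a) (qpi_surj b) (qpi_surj c) => x -> [y ->] [z ->].
by rewrite !qmulE mulrA.
Qed.
Lemma qmul1l : left_id qone qmul.
Proof. by move=> a; case: (qpi_surj a) => x ->; rewrite qmulE mul1r. Qed.
Lemma qmul1r : right_id qone qmul.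
Proof. by move=> a; case: (qpi_surj a) => x ->; rewrite qmulE mulr1. Qed.
Lemma qmulDl : left_distributive qmul +%R.
Proof.
move=> a b c; case: (qpi_surj a) (qpi_surj b) (qpi_surj c) => x -> [y ->] [z ->].
by rewrite -raddfD !qmulE -raddfD mulrDl.
Qed.
Lemma qmulDr : right_distributive qmul +%R.
Proof.
move=> a b c; case: (qpi_surj a) (qpi_surj b) (qpi_surj c) => x -> [y ->] [z ->].
by rewrite -raddfD !qmulE -raddfD mulrDr.
Qed.
HB.instance Definition _ :=
  GRing.Zmodule_isPzRing.Build quotalg qmulA qmul1l qmul1r qmulDl qmulDr.

Lemma qpi_monoid : monoid_morphism qpi.
Proof. by split=> // x y; rewrite -qmulE. Qed.
HB.instance Definition _ := GRing.isMonoidMorphism.Build T quotalg qpi qpi_monoid.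

Lemma qpiM x y : qpi (x * y) = qpi x * qpi y. Proof. exact: rmorphM. Qed.
Lemma qpiZ c x : qpi (c *: x) = c *: qpi x. Proof. exact: linearZ. Qed.

Lemma qscaleAl c (a b : quotalg) : c *: (a * b) = (c *: a) * b.
Proof.
case: (qpi_surj a) (qpi_surj b) => x -> [y ->].
by rewrite -qpiZ -!qpiM -qpiZ scalerAl.
Qed.
Lemma qscaleAr c (a b : quotalg) : c *: (a * b) = a * (c *: b).
Proof.
case: (qpi_surj a) (qpi_surj b) => x -> [y ->].
by rewrite -qpiZ -!qpiM -qpiZ scalerAr.
Qed.
End QuotAlg.

(* Associativity and right unitality compare elements of components whose
   indices are equal but not convertible, hence the use of [Tagged]. *)
Record gradedAlg (k : fieldType) := GradedAlg {
  gcomp :> nat -> lmodType k;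
  gone : gcomp 0;
  gmul : forall i j, gcomp i -> gcomp j -> gcomp (i + j);
  gmul_linl : forall i j (b : gcomp j), linear (fun a : gcomp i => gmul a b);
  gmul_linr : forall i j (a : gcomp i), linear (fun b : gcomp j => gmul a b);
  gmulA : forall i j l (a : gcomp i) (b : gcomp j) (c : gcomp l),
    Tagged gcomp (gmul a (gmul b c)) = Tagged gcomp (gmul (gmul a b) c);
  gmul1l : forall i (a : gcomp i), gmul gone a = a;
  gmul1r : forall i (a : gcomp i), Tagged gcomp (gmul a gone) = Tagged gcomp a }.

Definition gradedIso (k : fieldType) (G H : gradedAlg k) : Prop :=
  exists f : forall n, {linear G n -> H n},
    [/\ forall n, bijective (f n),
        f 0 (gone G) = gone H
      & forall i j (a : G i) (b : G j), f _ (gmul a b) = gmul (f i a) (f j b)].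

Section Gr.
Variables (k : fieldType) (T : algType k) (S : T -> Prop).
Local Notation A := (quotalg S).
Variable W : A -> Prop.

Fixpoint is_prod (n : nat) (a : A) : Prop :=
  if n is n'.+1 then exists w x, [/\ W w, is_prod n' x & a = w * x] else a = 1.

Definition Fil (n : nat) : submodClosed A := linspan (is_prod n).

Lemma is_prodM i j a b : is_prod i a -> is_prod j b -> is_prod (i + j) (a * b).
Proof.
elim: i a => [|i IH] a /=; first by move=> ->; rewrite mul1r.
by move=> [w [x [Ww xP ->]]] bP; exists w, (x * b); split; rewrite ?mulrA //; apply: IH.
Qed.

Lemma FilM i j a b : a \in Fil i -> b \in Fil j -> a * b \in Fil (i + j).
Proof.
move=> /asboolP aF /asboolP bF.
elim: aF => [|c s x sP _ IHx]; first by rewrite mul0r rpred0.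
rewrite mulrDl rpredD //; elim: bF => [|c' s' x' s'P _ IHx'].
  by rewrite mulr0 rpred0.
rewrite mulrDr rpredD // -qscaleAl -qscaleAr !rpredZ //.
by apply: mem_span; apply: is_prodM.
Qed.

Lemma Fil1 : 1 \in Fil 0.
Proof. exact: mem_span. Qed.

(* Membership in F_(n-1), where F_(-1) = 0. *)
Definition inLowFil (n : nat) (a : A) : bool :=
  if n is n'.+1 then a \in Fil n' else a == 0.

Lemma inLowFil0 n : inLowFil n 0.
Proof. by case: n => [|n] /=; rewrite ?eqxx ?rpred0. Qed.

Lemma inLowFil_lin n c a b : inLowFil n a -> inLowFil n b -> inLowFil n (c *: a + b).
Proof.
case: n => [/eqP -> /eqP -> | n aF bF] /=; first by rewrite scaler0 addr0.
by rewrite rpredD ?rpredZ.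
Qed.

Lemma inLowFilMl i j a b : inLowFil i a -> b \in Fil j -> inLowFil (i + j) (a * b).
Proof.
by case: i => [/eqP -> _|i aF bF]; [rewrite mul0r inLowFil0 | apply: FilM].
Qed.

Lemma inLowFilMr i j a b : a \in Fil i -> inLowFil j b -> inLowFil (i + j) (a * b).
Proof.
by case: j => [aF /eqP ->|j aF bF]; [rewrite mulr0 inLowFil0 | rewrite addnS; apply: FilM].
Qed.

Definition lowFil_pred n : {pred subspace (Fil n)} :=
  fun a => inLowFil n (subspace_val a).

Lemma lowFil_submod n : submod_closed (@lowFil_pred n).
Proof.
by split=> [|c x y]; [exact: inLowFil0 | exact: inLowFil_lin].
Qed.
HB.instance Definition _ n :=
  GRing.isSubmodClosed.Build k (subspace (Fil n)) (@lowFil_pred n) (@lowFil_submod n).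
Definition lowFil n : submodClosed (subspace (Fil n)) := @lowFil_pred n.

Definition gr (n : nat) : lmodType k := quotspace (lowFil n).

Definition grpi n (a : A) (aF : a \in Fil n) : gr n :=
  qproj (lowFil n) (Subspace a aF).

Lemma grpiP n a b (aF : a \in Fil n) (bF : b \in Fil n) :
  reflect (grpi aF = grpi bF) (inLowFil n (a - b)).
Proof. exact: qprojP. Qed.

Lemma grpi_surj n (u : gr n) : exists a (aF : a \in Fil n), u = grpi aF.
Proof.
exists (subspace_val (qrepr u)), (subspaceP (qrepr u)).
by rewrite /grpi -[LHS]qreprK; congr qproj; apply: val_inj.
Qed.

Definition grMul i j (u : gr i) (v : gr j) : gr (i + j) :=
  grpi (FilM (subspaceP (qrepr u)) (subspaceP (qrepr v))).

Lemma grpi_tagged m n a b (aF : a \in Fil m) (bF : b \in Fil n) :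
  m = n -> a = b -> Tagged gr (grpi aF) = Tagged gr (grpi bF).
Proof.
move=> emn eab; move: bF; rewrite -emn -eab => bF.
by rewrite (bool_irrelevance aF bF).
Qed.

Lemma grMulE i j a b (aF : a \in Fil i) (bF : b \in Fil j) :
  grMul (grpi aF) (grpi bF) = grpi (FilM aF bF).
Proof.
rewrite /grMul; set x := qrepr (grpi aF); set y := qrepr (grpi bF).
have xa : inLowFil i (subspace_val x - a).
  by apply/(grpiP (subspaceP x) aF); rewrite -[RHS]qreprK -/x /grpi; congr qproj; apply: val_inj.
have yb : inLowFil j (subspace_val y - b).
  by apply/(grpiP (subspaceP y) bF); rewrite -[RHS]qreprK -/y /grpi; congr qproj; apply: val_inj.
apply/grpiP; rewrite -[_ * _](subrK (subspace_val x * b)) -mulrBr -addrA -mulrBl.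
rewrite -[_ * _ in X in X + _]scale1r; apply: inLowFil_lin.
  by apply: inLowFilMr => //; apply: subspaceP.
exact: inLowFilMl.
Qed.

Lemma grpi_lin n c a b (aF : a \in Fil n) (bF : b \in Fil n)
    (cF : c *: a + b \in Fil n) :
  grpi cF = c *: grpi aF + grpi bF.
Proof.
by rewrite /grpi -linearP; congr qproj; apply: val_inj.
Qed.

Lemma grMul_linl i j (v : gr j) : linear (fun u : gr i => grMul u v).
Proof.
move=> c u u'; case: (grpi_surj v) => b [bF ->].
case: (grpi_surj u) (grpi_surj u') => a [aF ->] [a' [aF' ->]].
have cF : c *: a + a' \in Fil i by rewrite rpredD ?rpredZ.
rewrite -(grpi_lin aF aF' cF) !grMulE -grpi_lin; first last.
  by move=> cF'; apply/grpiP; rewrite mulrDl qscaleAl subrr inLowFil0.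
by rewrite rpredD ?rpredZ ?FilM.
Qed.

Lemma grMul_linr i j (u : gr i) : linear (fun v : gr j => grMul u v).
Proof.
move=> c v v'; case: (grpi_surj u) => a [aF ->].
case: (grpi_surj v) (grpi_surj v') => b [bF ->] [b' [bF' ->]].
have cF : c *: b + b' \in Fil j by rewrite rpredD ?rpredZ.
rewrite -(grpi_lin bF bF' cF) !grMulE -grpi_lin; first last.
  by move=> cF'; apply/grpiP; rewrite mulrDr qscaleAr subrr inLowFil0.
by rewrite rpredD ?rpredZ ?FilM.
Qed.

Lemma grMulA i j l (u : gr i) (v : gr j) (w : gr l) :
  Tagged gr (grMul u (grMul v w)) = Tagged gr (grMul (grMul u v) w).
Proof.
case: (grpi_surj u) (grpi_surj v) (grpi_surj w) => a [aF ->] [b [bF ->]] [c [cF ->]].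
by rewrite !grMulE; apply: grpi_tagged; rewrite ?addnA ?mulrA.
Qed.

Definition grOne : gr 0 := grpi Fil1.

Lemma grMul1l i (u : gr i) : grMul grOne u = u.
Proof.
case: (grpi_surj u) => a [aF ->]; rewrite grMulE.
by apply/grpiP; rewrite mul1r subrr inLowFil0.
Qed.

Lemma grMul1r i (u : gr i) : Tagged gr (grMul u grOne) = Tagged gr u.
Proof.
case: (grpi_surj u) => a [aF ->]; rewrite grMulE.
by apply: grpi_tagged; rewrite ?addn0 ?mulr1.
Qed.

Definition Gr : gradedAlg k :=
  GradedAlg grMul_linl grMul_linr grMulA grMul1l grMul1r.
End Gr.

(* T(U) is realized as the algebra of noncommutative polynomials in the basis
   [vbasis fullv] of U: the word [:: i1; ...; in] stands for
   e_i1 (x) ... (x) e_in. *)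
Section Tensor.
Variables (k : fieldType) (U : vectType k).
Local Notation r := (\dim {:U}).

Definition tensorAlg := {malg k[{fmonom 'I_r}]}.
HB.instance Definition _ := GRing.Lalgebra.on tensorAlg.

Lemma tensor_scalerAr c (x y : tensorAlg) : c *: (x * y) = x * (c *: y).
Proof.
have scC t : c *: t = t * c%:MP :> {malg k[{fmonom 'I_r}]}.
  rewrite malgM_def malgZ_def fgmulgU; apply: eq_bigr => m _.
  by rewrite mulm1 mulrC.
by rewrite [LHS]scC [c *: y]scC mulrA.
Qed.
HB.instance Definition _ :=
  GRing.Lalgebra_isAlgebra.Build k tensorAlg tensor_scalerAr.

Definition bas (i : 'I_r) : U := (vbasis {:U})`_i.
Definition word2 (i j : 'I_r) : {fmonom 'I_r} := mmul (fmu i) (fmu j).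

Definition tincl (u : U) : tensorAlg :=
  \sum_(i < r) coord (vbasis {:U}) i u *: << fmu i >>.

(* The n-th tensor power of U inside T(U). *)
Definition tpow_pred (n : nat) : {pred tensorAlg} :=
  fun t => `[< forall m : {fmonom 'I_r}, size m != n -> t@_m = 0 >].

Lemma tpow_submod n : submod_closed (tpow_pred n).
Proof.
split=> [|c x y]; first by apply/asboolP => m _; rewrite mcoeff0.
move=> /asboolP xP /asboolP yP; apply/asboolP => m mn.
by rewrite mcoeffD mcoeffZ xP // yP // mulr0 addr0.
Qed.
HB.instance Definition _ n :=
  GRing.isSubmodClosed.Build k tensorAlg (tpow_pred n) (tpow_submod n).
Definition tpow n : submodClosed tensorAlg := tpow_pred n.

Lemma tpow1 : 1 \in tpow 0.
Proof.
apply/asboolP => m m0; rewrite mcoeff1; case: (m =P mone) m0 => // ->.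
by rewrite fm1.
Qed.

Lemma tpowM i j x y : x \in tpow i -> y \in tpow j -> x * y \in tpow (i + j).
Proof.
move=> /asboolP xP /asboolP yP; apply/asboolP => m mn.
rewrite mcoeffMl big1 // => m1 _; rewrite big1 // => m2 _.
case: eqP => [e|_]; last by rewrite mulr0n.
have [s1|s1] := eqVneq (size m1) i; last by rewrite xP // mul0r.
have [s2|s2] := eqVneq (size m2) j; last by rewrite yP // mulr0.
by case/eqP: mn; rewrite -e fmM size_cat s1 s2.
Qed.

Lemma tincl_is_linear : linear tincl.
Proof.
move=> c u v; rewrite /tincl scaler_sumr -big_split; apply: eq_bigr => i _.
by rewrite linearP scalerDl scalerA.
Qed.
HB.instance Definition _ := GRing.isLinear.Build k U tensorAlg _ tincl tincl_is_linear.

Lemma word2_inj i j i' j' : (word2 i j == word2 i' j') = (i == i') && (j == j').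
Proof.
apply/eqP/andP => [/(congr1 (@fmonom_val _))|[/eqP -> /eqP -> //]].
by rewrite !fmM !fmU => -[-> ->].
Qed.

Lemma word2E i j : << fmu i >> * << fmu j >> = << word2 i j >> :> tensorAlg.
Proof. by rewrite malgM_def fgmulUU mulr1. Qed.

Lemma tincl2E u w :
  tincl u * tincl w = \sum_(i < r) \sum_(j < r)
    (coord (vbasis {:U}) i u * coord (vbasis {:U}) j w) *: << word2 i j >>.
Proof.
rewrite /tincl big_distrlr /=; apply: eq_bigr => i _; apply: eq_bigr => j _.
by rewrite -scalerAl -scalerAr scalerA word2E.
Qed.

Lemma mcoeff_sum (I : finType) (F : I -> tensorAlg) m :
  (\sum_i F i)@_m = \sum_i (F i)@_m.
Proof. by apply: (big_morph (fun x : tensorAlg => x@_m)) => [x y|]; rewrite (mcoeffD, mcoeff0). Qed.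

Lemma mcoeff_tincl2 u w i j :
  (tincl u * tincl w)@_(word2 i j)
  = coord (vbasis {:U}) i u * coord (vbasis {:U}) j w.
Proof.
rewrite tincl2E mcoeff_sum.
transitivity (\sum_(a < r) \sum_(b < r)
    coord (vbasis {:U}) a u * coord (vbasis {:U}) b w * ((a == i) && (b == j))%:R).
  apply: eq_bigr => a _; rewrite mcoeff_sum; apply: eq_bigr => b _.
  by rewrite -word2_inj -mcoeffU; apply: mcoeffZ.
rewrite (bigD1 i) //= (bigD1 j) //= !eqxx mulr1.
rewrite big1 => [|b bj]; last by rewrite (negbTE bj) mulr0.
rewrite big1 ?addr0 // => a ai; rewrite big1 // => b _.
by rewrite (negbTE ai) mulr0.
Qed.
End Tensor.

Section HomQuot.
Variables (k : fieldType) (U : vectType k) (S : tensorAlg U -> Prop).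
Local Notation B := (quotalg S).

(* The component of degree n: the image of the n-th tensor power.  The sum of
   the components is direct when S consists of homogeneous elements. *)
Definition homog_pred (n : nat) : {pred B} :=
  fun b => `[< exists2 t, t \in tpow U n & b = qpi S t >].

Lemma homog_submod n : submod_closed (homog_pred n).
Proof.
split=> [|c a b]; first by apply/asboolP; exists 0; rewrite ?rpred0 ?raddf0.
move=> /asboolP [x xn ->] /asboolP [y yn ->]; apply/asboolP.
by exists (c *: x + y); rewrite ?linearP // rpredD ?rpredZ.
Qed.
HB.instance Definition _ n :=
  GRing.isSubmodClosed.Build k B (homog_pred n) (homog_submod n).
Definition homog n : submodClosed B := homog_pred n.

Lemma homog1 : 1 \in homog 0.
Proof. by apply/asboolP; exists 1; rewrite ?tpow1. Qed.

Lemma homogM i j a b : a \in homog i -> b \in homog j -> a * b \in homog (i + j).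
Proof.
move=> /asboolP [x xi ->] /asboolP [y yj ->]; apply/asboolP.
by exists (x * y); rewrite ?qpiM ?tpowM.
Qed.

Definition hcomp (n : nat) : lmodType k := subspace (homog n).

Definition hMul i j (a : hcomp i) (b : hcomp j) : hcomp (i + j) :=
  Subspace (subspace_val a * subspace_val b : B) (homogM (subspaceP a) (subspaceP b)).

Definition hOne : hcomp 0 := Subspace (1 : B) homog1.

Lemma hcomp_tagged m n (a : hcomp m) (b : hcomp n) :
  m = n -> subspace_val a = subspace_val b -> Tagged hcomp a = Tagged hcomp b.
Proof. by move=> emn; move: a; rewrite emn => a ab; congr existT; apply: val_inj. Qed.

Lemma hMulE i j (a : hcomp i) (b : hcomp j) :
  subspace_val (hMul a b) = (subspace_val a : B) * (subspace_val b : B).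
Proof. by []. Qed.

Lemma hMul_linl i j (b : hcomp j) : linear (fun a : hcomp i => hMul a b).
Proof.
move=> c a a'; apply: subspace_inj.
by rewrite subspace_val_lin !hMulE subspace_val_lin mulrDl qscaleAl.
Qed.
Lemma hMul_linr i j (a : hcomp i) : linear (fun b : hcomp j => hMul a b).
Proof.
move=> c b b'; apply: subspace_inj.
by rewrite subspace_val_lin !hMulE subspace_val_lin mulrDr qscaleAr.
Qed.
Lemma hMulA i j l (a : hcomp i) (b : hcomp j) (c : hcomp l) :
  Tagged hcomp (hMul a (hMul b c)) = Tagged hcomp (hMul (hMul a b) c).
Proof. by apply: hcomp_tagged; [exact: addnA | rewrite !hMulE mulrA]. Qed.
Lemma hMul1l i (a : hcomp i) : hMul hOne a = a.
Proof. by apply: subspace_inj; rewrite hMulE mul1r. Qed.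
Lemma hMul1r i (a : hcomp i) : Tagged hcomp (hMul a hOne) = Tagged hcomp a.
Proof. by apply: hcomp_tagged; [exact: addn0 | rewrite hMulE mulr1]. Qed.

Definition gradedQuot : gradedAlg k :=
  GradedAlg hMul_linl hMul_linr hMulA hMul1l hMul1r.

(* The canonical map U -> B, an isomorphism onto B^1 when S lies in degree 2. *)
Definition gen (u : U) : B := qpi S (tincl u).
Lemma gen_linear : linear gen.
Proof. by move=> c u v; rewrite /gen !linearP. Qed.
HB.instance Definition _ := GRing.isLinear.Build k U B _ gen gen_linear.
End HomQuot.

Section Dual.
Variables (k : fieldType) (U : vectType k).

Definition dual : vectType k := 'Hom(U, k^o).

(* The pairing of U^* (x) U^* with U (x) U, in coordinates; only the components
   of degree 2 of the arguments matter. *)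
Definition pair2 (p : tensorAlg dual) (t : tensorAlg U) : k :=
  \sum_a \sum_b \sum_i \sum_j
    p@_(word2 a b) * t@_(word2 i j) * (bas a (bas i) * bas b (bas j)).

Lemma dual_coord (f : dual) (u : U) :
  f u = \sum_a \sum_i coord (vbasis {:dual}) a f * coord (vbasis {:U}) i u * bas a (bas i).
Proof.
rewrite {1}(coord_vbasis (memvf f)) sum_lfunE; apply: eq_bigr => a _.
rewrite scale_lfunE {1}(coord_vbasis (memvf u)) linear_sum scaler_sumr.
by apply: eq_bigr => i _; rewrite linearZ /= scalerA.
Qed.

Lemma pair2E (f g : dual) (u w : U) :
  pair2 (tincl f * tincl g) (tincl u * tincl w) = f u * g w.
Proof.
rewrite (dual_coord f u) (dual_coord g w) /pair2 [RHS]big_distrlr.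
apply: eq_bigr => a _; apply: eq_bigr => b _; rewrite [RHS]big_distrlr.
apply: eq_bigr => i _; apply: eq_bigr => j _; rewrite !mcoeff_tincl2.
by rewrite (mulrACA (coord _ a f)) [LHS]mulrACA.
Qed.

Lemma pair2_lin c (p q : tensorAlg dual) t :
  pair2 (c *: p + q) t = c * pair2 p t + pair2 q t.
Proof.
rewrite /pair2 mulr_sumr -big_split; apply: eq_bigr => a _.
rewrite mulr_sumr -big_split; apply: eq_bigr => b _.
rewrite mulr_sumr -big_split; apply: eq_bigr => i _.
rewrite mulr_sumr -big_split; apply: eq_bigr => j _ /=.
by rewrite mcoeffD mcoeffZ !mulrDl !mulrA.
Qed.

Lemma pair20 t : pair2 0 t = 0.
Proof. by have := pair2_lin (-1) 0 0 t; rewrite scaler0 addr0 mulN1r addNr. Qed.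

Lemma pair2Z c p t : pair2 (c *: p) t = c * pair2 p t.
Proof. by have := pair2_lin c p 0 t; rewrite addr0 pair20 addr0. Qed.

Lemma pair2_sum (I : finType) (p : I -> tensorAlg dual) t :
  pair2 (\sum_i p i) t = \sum_i pair2 (p i) t.
Proof.
apply: (big_morph (fun p => pair2 p t)) => [x y|]; last exact: pair20.
by have := pair2_lin 1 x y t; rewrite scale1r mul1r.
Qed.

(* R^perp, for R in U (x) U *)
Definition annihilator (R : tensorAlg U -> Prop) (p : tensorAlg dual) : Prop :=
  p \in tpow dual 2 /\ forall t, R t -> pair2 p t = 0.

Definition quadDual (R : tensorAlg U -> Prop) : gradedAlg k :=
  gradedQuot (annihilator R).
End Dual.

Definition projective (R : pzRingType) (P : lmodType R) : Prop :=
  forall (M N : lmodType R) (g : {linear M -> N}) (f : {linear P -> N}),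
    (forall y, exists x, g x = y) ->
    exists f' : {linear P -> M}, forall x, g (f' x) = f x.

Section Koszul.
Variables (k : fieldType) (U : vectType k) (S : tensorAlg U -> Prop).
Local Notation B := (quotalg S).

(* The B-linear maps from M to the trivial module k = B / B_+. *)
Definition to_triv (M : lmodType B) (f : M -> k) : Prop :=
  [/\ forall x y, f (x + y) = f x + f y,
      forall c x, f ((c *: (1 : B)) *: x) = c * f x
    & forall n (b : B) x, b \in homog S n.+1 -> f (b *: x) = 0].

(* A projective resolution ... -> P_1 -> P_0 -> k -> 0 of the trivial module. *)
Record projRes := ProjRes {
  res :> nat -> lmodType B;
  res_d : forall n, {linear res n.+1 -> res n};
  res_aug : res 0 -> k;
  res_aug_triv : to_triv res_aug;
  res_proj : forall n, projective (res n);
  res_aug_surj : forall c, exists x, res_aug x = c;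
  res_exact0 : forall x, res_aug x = 0 <-> exists y, x = res_d 0 y;
  res_exact : forall n x, res_d n x = 0 <-> exists y, x = res_d n.+1 y }.

Section Ext.
Variable P : projRes.

(* Ext^n_B(k, k) is the space of cocycles P_n -> k modulo coboundaries. *)
Definition cocycle n (f : P n -> k) : Prop :=
  to_triv f /\ forall x, f (res_d P n x) = 0.

Definition coboundary n : (P n -> k) -> Prop :=
  match n with
  | 0 => fun f => forall x, f x = 0
  | n'.+1 => fun f => exists2 w : P n' -> k, to_triv w & forall x, f x = w (res_d P n' x)
  end.

(* h represents the Yoneda product of the classes of the cocycles g and f:
   h = g o phi_m, where phi_i : P_(i + n) -> P_i is a chain map lifting f. *)
Definition yoneda m n (g : P m -> k) (f : P n -> k) (h : P (m + n) -> k) : Prop :=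
  exists phi : forall i, {linear P (i + n)%N -> P i},
    [/\ forall x : P n, res_aug (phi 0 x) = f x,
        forall i (x : P (i + n).+1), res_d P i (phi i.+1 x) = phi i (res_d P (i + n) x)
      & forall x, h x = g (phi m x)].

(* The cocycles whose class lies in the subalgebra generated by Ext^1. *)
Inductive ext1_gen : forall n, (P n -> k) -> Prop :=
| ext1_gen1 : ext1_gen (res_aug (p:=P))
| ext1_genE (f : P 1 -> k) : cocycle f -> ext1_gen f
| ext1_genL n c (f g : P n -> k) :
    ext1_gen f -> ext1_gen g -> ext1_gen (fun x => c * f x + g x)
| ext1_genM m n (g : P m -> k) (f : P n -> k) h :
    ext1_gen g -> ext1_gen f -> yoneda g f h -> ext1_gen h
| ext1_genB n (f g : P n -> k) :
    ext1_gen f -> coboundary (fun x => g x - f x) -> ext1_gen g.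
End Ext.

(* Ext_B(k, k) does not depend on the choice of the resolution. *)
Definition koszul : Prop :=
  forall (P : projRes) n (f : P n -> k), cocycle f -> ext1_gen f.
End Koszul.

Section CDG.
Variables (k : fieldType) (U : vectType k) (S : tensorAlg U -> Prop).
Local Notation B := (quotalg S).

(* The supercommutator of homogeneous elements a, b of degrees i, j. *)
Definition scomm i j (a b : B) : B := a * b - (-1) ^+ (i * j) * (b * a).

Record isCDG (d : B -> B) (h : B) : Prop := IsCDG {
  cdg_deg : forall n a, a \in homog S n -> d a \in homog S n.+1;
  cdg_leibniz : forall i a b, a \in homog S i -> d (a * b) = d a * b + (-1) ^+ i * (a * d b);
  cdg_curv : h \in homog S 2;
  cdg_sq : forall j a, a \in homog S j -> d (d a) = scomm 2 j h a;
  cdg_bianchi : d h = 0 }.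
End CDG.

Record quadCDG (k : fieldType) := QuadCDG {
  cdgU : vectType k;
  cdgR : submodClosed (tensorAlg cdgU);
  cdgR_quad : {subset cdgR <= tpow cdgU 2};
  cdgB := quotalg (fun t => t \in cdgR);
  cdgd : {linear cdgB -> cdgB};
  cdgh : cdgB;
  cdgP : isCDG cdgd cdgh }.

Section APsi.
Variables (k : fieldType) (Psi : quadCDG k).
Local Notation U := (cdgU Psi).
Local Notation R := (fun t : tensorAlg (cdgU Psi) => t \in cdgR Psi).
Local Notation B := (cdgB Psi).
(* V = (B^1)^*, where B^1 is identified with U. *)
Local Notation V := (dual (cdgU Psi)).

Definition dual_bas (i : 'I_(\dim {:U})) : V :=
  linfun (coord (vbasis {:U}) i : U -> k^o).

(* An element of I = (B^2)^* is given by a linear functional p on B, of which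
   only the restriction to B^2 is used.  It is sent to V (x) V by the dual of
   the multiplication B^1 (x) B^1 -> B^2. *)
Definition Iincl (p : {linear B -> k^o}) : tensorAlg V :=
  \sum_i \sum_j (p (gen R (bas i) * gen R (bas j)) : k)
    *: (tincl (dual_bas i) * tincl (dual_bas j)).

(* The dual of d : B^1 -> B^2. *)
Definition Iphi (p : {linear B -> k^o}) : V :=
  linfun (fun u : U => p (cdgd Psi (gen R u))).

Lemma IphiE p u : Iphi p u = p (cdgd Psi (gen R u)).
Proof. exact: (lfunE (p \o cdgd Psi \o gen R)). Qed.

Lemma dual_basE i u : dual_bas i u = coord (vbasis {:U}) i u.
Proof. exact: (lfunE (coord (vbasis {:U}) i : {linear U -> k^o})). Qed.

Lemma IinclE p u w :
  pair2 (Iincl p) (tincl u * tincl w) = p (gen R u * gen R w).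
Proof.
have genE v : gen R v = \sum_i coord (vbasis {:U}) i v *: gen R (bas i).
  by rewrite {1}(coord_vbasis (memvf v)) linear_sum; apply: eq_bigr => i _; rewrite linearZ.
have pE : p (gen R u * gen R w) = \sum_i \sum_j
    coord (vbasis {:U}) i u * coord (vbasis {:U}) j w * p (gen R (bas i) * gen R (bas j)).
  rewrite (genE u) (genE w) mulr_suml linear_sum; apply: eq_bigr => i _.
  rewrite mulr_sumr linear_sum; apply: eq_bigr => j _.
  by rewrite -qscaleAl -qscaleAr !linearZ; apply: mulrA.
rewrite pE /Iincl pair2_sum; apply: eq_bigr => i _.
rewrite pair2_sum; apply: eq_bigr => j _.
rewrite pair2Z pair2E !dual_basE; exact: mulrC.
Qed.

Definition Arel (x : tensorAlg V) : Prop :=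
  exists p : {linear B -> k^o},
    x = Iincl p + tincl (Iphi p) + (p (cdgh Psi) : k) *: 1.

Definition algA := quotalg Arel.

Definition inW (a : algA) : Prop :=
  exists (c : k) (v : V), a = c *: (1 : algA) + gen Arel v.

Definition GrA : gradedAlg k := Gr inW.
End APsi.

(* Main.v *)
(** The defining relations of [A(Psi)] let one replace an element of the relation
    space [I] of [B^!] by an element of lower degree, which gives a surjection
    from [B^!] onto [Gr A(Psi)].  It is injective when each linear form on [T(V)_n]
    that vanishes on the ideal [(I)] extends to a form on [T(V)], zero in degrees
    below [n], that vanishes on the inhomogeneous relations.  Such an extension is
    built one degree at a time.  The obstruction to the next step is a cycle
    with values in [B_2] of the Koszul complex [B (x) (B^!)^*], by the identities
    satisfied by [d] and [h], and a boundary corrects the extension.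

    Exactness of the Koszul complex is deduced from the generation of
    [Ext_B(k, k)] by [Ext^1]: a cocycle [f] of degree [n + 1] on a projective
    resolution [P] which is a combination of products of classes of degree one
    satisfies [f x = 0] whenever [d x] lies in [B_+ B_+ P_n].  If the Koszul complex
    is exact below [m], it is the beginning of a resolution, so cycles of degree
    [m] with coefficients in [B_+ B_+] lie in [B_+ Z_m]; induction on the internal
    degree shows that they are boundaries. *)

Require Import Defs.
From HB Require Import structures.
From mathcomp Require Import all_boot all_order all_algebra.
From mathcomp Require Import finmap boolp classical_sets functions monalg.

Set Implicit Arguments.
Unset Strict Implicit.
Unset Printing Implicit Defensive.

Import GRing.Theory.
Local Open Scope ring_scope.

(** * Linear algebra *)

(** The definition of [koszul] quantifies over all resolutions by projective modules without a
    grading, where the internal degree of a class has no meaning. The submodule [B_+ B_+ P_n] takes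
    its place: every [B]-linear map respects it, hence so do the chain maps that compute Yoneda
    products. Since the Koszul complex is known to be exact only below [m] at that stage, a free
    resolution of its module of cycles [Z_m] completes it to a full resolution.

    Tensor products are avoided: an element of [B (x) (B^!_m)^*] is a [B]-valued function on words
    of length [m], and an identity in a tensor product is tested by all linear forms on one factor.
    This requires separating forms on spaces of arbitrary dimension, hence Zorn's lemma.

    An element of an ideal involves finitely many relations, so it is enough to extend a form
    compatibly with the relations up to a finite degree; no limit is formed. *)

Lemma linear_map_exists (R : pzRingType) (M N : lmodType R) (f : M -> N) :
  linear f -> exists F : {linear M -> N}, forall x, F x = f x.
Proof.
move=> fl.
pose m := GRing.isLinear.Build R M N *:%R f fl.
by exists (HB.pack_for {linear M -> N} (f : M -> N) m).
Qed.

Section LinearForms.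
Variables (k : fieldType) (M : lmodType k).

Lemma linear_form_exists (f : M -> k) :
  (forall c x y, f (c *: x + y) = c * f x + f y) ->
  exists F : {linear M -> k^o}, forall x, F x = f x.
Proof. exact: (@linear_map_exists k M k^o f). Qed.

(** Zorn's lemma is applied to the sets [A] whose union with [X] is a subspace avoiding [x0]. A
    maximal one gives a hyperplane complementary to [x0], and [F] is the coefficient of [x0]. Taking
    the union with [X], instead of asking that [A] contain [X], makes the empty chain harmless. *)
Lemma separating_form (X : submodClosed M) x0 : x0 \notin X ->
  exists F : {linear M -> k^o}, (forall x, x \in X -> F x = 0) /\ F x0 = 1.
Proof.
move=> x0X; pose Y (A : set M) x := x \in X \/ A x.
pose P (A : set M) :=
  ~ Y A x0 /\ forall c x y, Y A x -> Y A y -> Y A (c *: x + y).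
have [F FP Ftot|A [[x0A Alin] Amax]] := @Zorn_bigcup M P.
  split=> [[x0inX|[A FA Ax0]]|c x y xY yY]; first by rewrite x0inX in x0X.
    by case: (FP A FA) => + _; apply; right.
  suff [A [F'A xA yA]] : exists A, [/\ F A \/ A = set0, Y A x & Y A y].
    case: F'A => [FA|A0].
      case: (FP A FA) => _ /(_ c x y xA yA)[]; first by left.
      by move=> Ac; right; exists A.
    move: xA yA; rewrite A0 => -[xX|//] [yX|//].
    by left; rewrite rpredD ?rpredZ.
  case: xY yY => [xX|[A FA Ax]] [yX|[A' FA' A'y]].
  - by exists set0; split; [right|left|left].
  - by exists A'; split; [left|left|right].
  - by exists A; split; [left|right|left].
  - have [AA'|A'A] := Ftot A A' FA FA'.
      by exists A'; split; [left|right; apply: AA'|right].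
    by exists A; split; [left|right|right; apply: A'A].
have Y0 : Y A 0 by left; apply: rpred0.
have YD x y : Y A x -> Y A y -> Y A (x + y).
  by rewrite -[x in x + y]scale1r; apply: Alin.
have YZ c x : Y A x -> Y A (c *: x).
  by move=> Ax; rewrite -[_ *: _]addr0; apply: Alin.
have ex m : exists c, Y A (m - c *: x0).
  have [mA|mA] := pselect (Y A m); first by exists 0; rewrite scale0r subr0.
  (* [A'] is spanned by [m] and the maximal subspace. By maximality it contains [x0]; solving that
     equation for [m] gives [c]. *)
  pose A' : set M := fun x => exists c y, Y A y /\ x = c *: m + y.
  have AA' x : Y A x -> A' x by exists 0, x; rewrite scale0r add0r.
  have A'm : A' m by exists 1, 0; rewrite scale1r addr0.
  have /Amax : (A `<` A')%classic.
    split=> [x Ax|/(_ m A'm) Am]; first by apply: AA'; right.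
    by apply: mA; right.
  have YA' x : Y A' x <-> A' x.
    by split=> [[xX|//]|]; [apply: AA'; left|right].
  move=> nP; have /YA'[c [y [yY x0E]]] : Y A' x0.
    apply: contrapT => nx0; apply: nP; split=> // c x y.
    move=> /YA' [c1 [y1 [y1Y ->]]] /YA' [c2 [y2 [y2Y ->]]]; apply/YA'.
    exists (c * c1 + c2), (c *: y1 + y2); split; first exact: Alin.
    by rewrite scalerDr scalerA addrACA -scalerDl.
  have c0 : c != 0.
    by apply/eqP => c0; apply: x0A; rewrite x0E c0 scale0r add0r.
  exists c^-1; rewrite x0E scalerDr scalerA mulVf // scale1r opprD addNKr.
  by rewrite -scalerN; apply: (YZ); rewrite -scaleN1r; apply: YZ.
pose f m := projT1 (cid (ex m)).
have fP m : Y A (m - f m *: x0) by rewrite /f; case: cid.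
have fu m c : Y A (m - c *: x0) -> f m = c.
  move=> cP; apply/eqP; rewrite -subr_eq0; apply/eqP; apply: contrapT => /eqP n0.
  apply: x0A; rewrite -[x0](scale1r) -(mulVf n0) -scalerA; apply: YZ.
  have -> : (f m - c) *: x0 = -1 *: (m - f m *: x0) + (m - c *: x0).
    by rewrite scaleN1r opprB scalerBl addrA subrK.
  exact: Alin.
have [c x y|F FE] := @linear_form_exists f.
  apply: fu; rewrite scalerDl -scalerA opprD addrACA -scalerBr.
  by apply: YD; [apply: YZ|]; apply: fP.
exists F; split=> [x xX|]; rewrite FE; apply: fu.
  by rewrite scale0r subr0; left.
by rewrite scale1r subrr.
Qed.

Lemma linear_forms_eq x y : (forall F : {linear M -> k^o}, F x = F y) -> x = y.
Proof.
move=> FE; apply/eqP; rewrite -subr_eq0; apply/negP => /negP xy.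
pose X := linspan (fun _ : M => False).
have : x - y \notin X.
  by apply: contra xy => /asboolP []//.
move=> /separating_form[F [_]]; rewrite linearB FE subrr => /eqP.
by rewrite eq_sym oner_eq0.
Qed.

(* The forms [u.1] and the vectors encoded by the lists [u.2] are dual bases of
   the span of the family. *)
Lemma finite_dual_basis (I : eqType) (y : I -> M) (s : seq I) :
  exists ps : seq ({linear M -> k^o} * seq (k * I)), forall j, j \in s ->
    y j = \sum_(u <- ps) u.1 (y j) *: \sum_(q <- u.2) q.1 *: y q.2.
Proof.
elim: s => [|j0 s [ps psP]]; first by exists [::].
pose X := linspan (fun m => exists2 j, j \in s & m = y j).
have [yX|/separating_form[F [FX Fy]]] := boolP (y j0 \in X).
  exists ps => j; rewrite inE => /predU1P[->|/psP//].
  move: yX => /asboolP; elim=> [|c _ m [i si ->] _ {1}->].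
    by rewrite big1 // => u _; rewrite linear0 scale0r.
  rewrite {1}(psP i si) scaler_sumr -big_split; apply: eq_bigr => u _ /=.
  by rewrite scalerA -scalerDl linearP.
(* The new vector is [y j0] minus its projection to the earlier span, as in Gram-Schmidt. *)
have [L LE] : exists L : seq (k * I), \sum_(q <- L) q.1 *: y q.2 =
    y j0 - \sum_(u <- ps) u.1 (y j0) *: \sum_(q <- u.2) q.1 *: y q.2.
  elim: ps {psP} => [|[p l] ps [L LE]].
    by exists [:: (1, j0)]; rewrite big_nil big_seq1 scale1r subr0.
  exists ([seq (- p (y j0) * q.1, q.2) | q <- l] ++ L).
  rewrite big_cat LE big_cons opprD addrCA; congr (_ + _).
  rewrite big_map scaler_sumr -sumrN; apply: eq_bigr => q _.
  by rewrite scalerA mulNr scaleNr.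
exists ((F, L) :: ps) => j; rewrite inE big_cons /= => /predU1P[->|js].
  by rewrite Fy scale1r LE subrK.
by rewrite FX ?scale0r ?add0r; [apply: psP | apply: mem_span; exists j].
Qed.
End LinearForms.

Lemma sum_mul3 (R : pzRingType) N N' (a : 'I_N -> R) s (b : 'I_N' -> R) :
  (\sum_i a i) * s * (\sum_j b j) = \sum_i \sum_j a i * s * b j.
Proof.
rewrite [X in X * _]mulr_suml mulr_suml.
by apply: eq_bigr => i _; rewrite mulr_sumr.
Qed.

Lemma contract_bilinear (k : fieldType) (M : lmodType k) (I J : finType)
  (P : I -> I -> k) (A : J -> I -> k) (W : J -> J -> M) :
  \sum_i \sum_j P i j *: (\sum_a \sum_b (A a i * A b j) *: W a b)
  = \sum_a \sum_b (\sum_i \sum_j A a i * A b j * P i j) *: W a b.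
Proof.
transitivity (\sum_i \sum_j \sum_a \sum_b (A a i * A b j * P i j) *: W a b).
  apply: eq_bigr => i _; apply: eq_bigr => j _; rewrite scaler_sumr.
  apply: eq_bigr => a _; rewrite scaler_sumr; apply: eq_bigr => b _.
  by rewrite scalerA mulrC.
under eq_bigr => i _ do rewrite exchange_big.
rewrite exchange_big; apply: eq_bigr => a _ /=.
under eq_bigr => i _ do rewrite exchange_big.
rewrite exchange_big; apply: eq_bigr => b _ /=.
rewrite scaler_suml; apply: eq_bigr => i _.
by rewrite scaler_suml.
Qed.

Lemma sum_delta2 (k : fieldType) (M : lmodType k) (I : finType) c (g : I -> I -> k)
    (W : I -> I -> M) i j :
  \sum_a \sum_b (c * ((a == i)%:R * (b == j)%:R) + g a b) *: W a b
  = c *: W i j + \sum_a \sum_b g a b *: W a b.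
Proof.
under eq_bigr => a _.
  under eq_bigr => b _ do rewrite scalerDl.
  rewrite big_split.
  over.
rewrite big_split; congr (_ + _).
rewrite (bigD1 i) //= (bigD1 j) //= !eqxx !mulr1.
rewrite big1 ?addr0 => [|b /negbTE bj]; last by rewrite bj !mulr0 scale0r.
rewrite big1 ?addr0 // => a /negbTE ai; rewrite big1 // => b _.
by rewrite ai mul0r mulr0 scale0r.
Qed.

Section AlgebraSpans.
Variables (k : fieldType) (T : algType k).

Lemma span_sandwich (S Q : T -> Prop) s :
  Q 0 -> (forall c y z, Q y -> Q z -> Q (c *: y + z)) ->
  (forall u v, S u -> S v -> Q (u * s * v)) ->
  forall a b, a \in linspan S -> b \in linspan S -> Q (a * s * b).
Proof.
move=> Q0 Qlin QS a b /asboolP aS /asboolP bS; elim: aS => [|c u a' Su _ IHa].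
  by rewrite !mul0r.
rewrite !mulrDl -!scalerAl; apply: (Qlin _ _ _ _ IHa); elim: bS => [|c' v b' Sv _ IHb].
  by rewrite mulr0.
by rewrite mulrDr -scalerAr; apply: (Qlin _ _ _ _ IHb); apply: QS.
Qed.

Lemma sum_sandwich (I : finType) (c : I -> k) (W : I -> T) u v :
  u * (\sum_i c i *: W i) * v = \sum_i c i *: (u * W i * v).
Proof.
rewrite mulr_sumr mulr_suml; apply: eq_bigr => i _.
by rewrite -scalerAr -scalerAl.
Qed.

Lemma form_mul_sums (I : finType) (p : {linear T -> k^o}) (c c' : I -> k) (y : I -> T) :
  p ((\sum_i c i *: y i) * (\sum_j c' j *: y j))
  = \sum_i \sum_j c i * c' j * p (y i * y j).
Proof.
rewrite mulr_suml linear_sum; apply: eq_bigr => i _.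
rewrite mulr_sumr linear_sum; apply: eq_bigr => j _.
by rewrite -scalerAl -scalerAr scalerA linearZ.
Qed.

Lemma scalar_sandwich c c' (s : T) : c *: 1 * s * (c' *: 1) = (c * c') *: s.
Proof. by rewrite -scalerAr mulr1 -scalerAl mul1r scalerA mulrC. Qed.
End AlgebraSpans.

Lemma inj_surj_bij (A B : Type) (f : A -> B) :
  injective f -> (forall y, exists x, f x = y) -> bijective f.
Proof.
move=> finj fsurj; exists (fun y => projT1 (cid (fsurj y))) => [x|y].
  by apply: finj; case: cid.
by case: cid.
Qed.

(** * Modules and resolutions *)

Section Preimage.
Variables (R : pzRingType) (M N : lmodType R) (f : {linear M -> N}).
Variable X : submodClosed N.

Definition preim_pred : {pred M} := fun x => f x \in X.
Lemma preim_submod : submod_closed preim_pred.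
Proof.
split=> [|c x y xX yX]; rewrite -[_ \in preim_pred]/(f _ \in X).
  by rewrite linear0 rpred0.
by rewrite linearP rpredD ?rpredZ.
Qed.
HB.instance Definition _ := GRing.isSubmodClosed.Build R M preim_pred preim_submod.
Definition preim_sub : submodClosed M := preim_pred.
End Preimage.

Section Submodule.
Variables (R : pzRingType) (M : lmodType R) (X : submodClosed M).

Record submod := Submod { submod_val :> M; submodP : submod_val \in X }.
HB.instance Definition _ := [isSub for submod_val].
HB.instance Definition _ := [Choice of submod by <:].
HB.instance Definition _ := [SubChoice_isSubLmodule of submod by <:].

Lemma submod_valD (f g : submod) : submod_val (f + g) = submod_val f + submod_val g.
Proof. exact: (raddfD (val : submod -> M)). Qed.

Lemma submod_valZ b (f : submod) : submod_val (b *: f) = b *: submod_val f.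
Proof. exact: (linearZ_LR (val : submod -> M)). Qed.
End Submodule.
Arguments submod_val {R M X} _.

Section Kernel.
Variables (R : pzRingType) (M N : lmodType R) (f : {linear M -> N}).

Definition ker_pred : {pred M} := fun x => f x == 0.
Lemma ker_submod : submod_closed ker_pred.
Proof.
split=> [|c x y]; rewrite !unfold_in ?linear0 // => /eqP fx /eqP fy.
by rewrite linearP fx fy scaler0 addr0.
Qed.
HB.instance Definition _ := GRing.isSubmodClosed.Build R M ker_pred ker_submod.
Definition ker : submodClosed M := ker_pred.
End Kernel.

(** * Free modules and free resolutions *)

Section FreeModule.
Variables (R : pzRingType) (Z : choiceType).

Definition freemod := malg Z R.
HB.instance Definition _ := GRing.Zmodule.on freemod.

Implicit Types g : freemod.

Definition frscale (c : R) (g : freemod) : freemod :=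
  [malg z in msupp g => c * g@_z].

Lemma frscaleE c g z : (frscale c g)@_z = c * g@_z.
Proof. by rewrite mcoeffE; case: msuppP; rewrite ?mulr0. Qed.

Lemma frscaleA a b g : frscale a (frscale b g) = frscale (a * b) g.
Proof. by apply/malgP=> z; rewrite !frscaleE mulrA. Qed.
Lemma frscale1 : left_id 1 frscale.
Proof. by move=> g; apply/malgP=> z; rewrite frscaleE mul1r. Qed.
Lemma frscaleDr : right_distributive frscale +%R.
Proof.
by move=> c g h; apply/malgP=> z; rewrite !(mcoeffD, frscaleE) mulrDr.
Qed.
Lemma frscaleDl g : {morph frscale^~ g : a b / a + b}.
Proof.
by move=> a b; apply/malgP=> z; rewrite !(mcoeffD, frscaleE) mulrDl.
Qed.
HB.instance Definition _ :=
  GRing.Zmodule_isLmodule.Build R freemod frscaleA frscale1 frscaleDr frscaleDl.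

Section Lift.
Variables (M : lmodType R) (n : Z -> M).

Definition frlift (g : freemod) : M := \sum_(z <- msupp g) g@_z *: n z.

Lemma frliftw (D : {fset Z}) g : fsubset (msupp g) D ->
  frlift g = \sum_(z <- D) g@_z *: n z.
Proof.
move=> gD; apply: big_fset_incl => // z _ /mcoeff_outdom ->.
by rewrite scale0r.
Qed.

Lemma frlift_is_linear : linear frlift.
Proof.
move=> c g h; pose D := (msupp g `|` msupp h `|` msupp (c *: g + h))%fset.
rewrite !(@frliftw D); last 3 first.
- by apply/fsubsetP=> z zg; rewrite !in_fsetU zg ?orbT.
- by apply/fsubsetP=> z zg; rewrite !in_fsetU zg ?orbT.
- by apply/fsubsetP=> z zg; rewrite !in_fsetU zg ?orbT.
rewrite scaler_sumr -big_split; apply: eq_bigr => z _ /=.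
by rewrite mcoeffD [(c *: g)@_z]frscaleE scalerDl scalerA.
Qed.
HB.instance Definition _ :=
  GRing.isLinear.Build R freemod M _ frlift frlift_is_linear.

Lemma frliftU z : frlift << 1 *g z >> = n z.
Proof.
by rewrite (frliftw msuppU_le) big_seq_fset1 mcoeffUU scale1r.
Qed.
End Lift.

Lemma freemodE (g : freemod) :
  g = \sum_(z <- msupp g) g@_z *: (<< 1 *g z >> : freemod).
Proof.
rewrite {1}[g]monalgE; apply: eq_bigr => z _; apply/malgP=> z'.
by rewrite [RHS]frscaleE !mcoeffU mulrnAr mulr1.
Qed.

Lemma freemod_projective : projective freemod.
Proof.
move=> M N g f gsurj.
pose n z := projT1 (cid (gsurj (f << 1 *g z >>))).
have nE z : g (n z) = f << 1 *g z >> by rewrite /n; case: cid.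
exists (frlift n) => x; rewrite [in RHS](freemodE x) /= /frlift !linear_sum.
by apply: eq_bigr => z _; rewrite !linearZ /= nE.
Qed.
End FreeModule.

(* A projective resolution of an arbitrary module, to be spliced with finitely
   many terms of the Koszul complex. *)
Record resolution (R : pzRingType) (Z : lmodType R) := Resolution {
  rs :> nat -> lmodType R;
  rd : forall n, {linear rs n.+1 -> rs n};
  raug : {linear rs 0 -> Z};
  rproj : forall n, projective (rs n);
  raug_surj : forall z, exists x, raug x = z;
  rexact0 : forall x, raug x = 0 <-> exists y, x = rd 0 y;
  rexact : forall n x, rd n x = 0 <-> exists y, x = rd n.+1 y }.

Section FreeResolution.
Variables (R : pzRingType) (Z : lmodType R).

(** The free module on all elements of [Y]: the size of a resolution does not matter here. *)
Definition fcover (Y : lmodType R) : {linear freemod R Y -> Y} := frlift id.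

Lemma fcover_surj (Y : lmodType R) y : exists x, fcover Y x = y.
Proof. by exists << 1 *g y >>; apply: frliftU. Qed.

Fixpoint syzygy (n : nat) : lmodType R :=
  if n is n'.+1 then submod (ker (fcover (syzygy n'))) else Z.

Definition syz_d n : {linear freemod R (syzygy n.+1) -> freemod R (syzygy n)} :=
  (val : submod (ker (fcover (syzygy n))) -> _) \o fcover (syzygy n.+1).

Lemma syz_exact n x : fcover (syzygy n) x = 0 <-> exists y, x = syz_d n y.
Proof.
split=> [x0|[y ->]]; last exact/eqP/(submodP (fcover (syzygy n.+1) y)).
have xk : x \in ker (fcover (syzygy n)) by apply/eqP.
have [y yE] := fcover_surj (Submod xk : syzygy n.+1).
by exists y; rewrite /= yE.
Qed.

Lemma syz_d_eq0 n x : syz_d n x = 0 <-> fcover (syzygy n.+1) x = 0.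
Proof.
split=> x0; last by rewrite /syz_d /= x0.
by apply: val_inj; rewrite -[LHS]/(syz_d n x) x0.
Qed.

Lemma free_resolution : resolution Z.
Proof.
exists (fun n => freemod R (syzygy n) : lmodType R) syz_d (fcover Z).
- by move=> n; apply: freemod_projective.
- exact: fcover_surj.
- exact: (@syz_exact 0).
- by move=> n x; rewrite syz_d_eq0; apply: syz_exact.
Defined.
End FreeResolution.

(** * Cocycles generated in degree one *)

Section AugmentationSquare.
Variables (R : pzRingType) (H : nat -> {pred R}).

(* The submodule R_+ R_+ M, for R graded by H. *)
Inductive in_aug2 (M : lmodType R) : M -> Prop :=
| in_aug20 : in_aug2 0
| in_aug2D i j (b c : R) y x :
    b \in H i.+1 -> c \in H j.+1 -> in_aug2 x ->
    in_aug2 (b *: (c *: y) + x).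

Lemma in_aug2_lin (M N : lmodType R) (f : {linear M -> N}) x :
  in_aug2 x -> in_aug2 (f x).
Proof.
elim=> [|i j b c y z bi cj _ IH]; first by rewrite linear0; constructor.
by rewrite linearD !linearZ; apply: (in_aug2D _ bi cj).
Qed.
End AugmentationSquare.

Section Koszul.
Variables (k : fieldType) (U : vectType k) (S : tensorAlg U -> Prop).
Local Notation B := (quotalg S).
Local Notation in_aug2 := (in_aug2 (fun n => homog S n)).

Lemma to_triv_aug2 (M : lmodType B) (f : M -> k) x :
  to_triv f -> in_aug2 x -> f x = 0.
Proof.
move=> [fD fZ f0]; elim=> [|i j b c y z bi _ _ IH].
  by rewrite -(scale0r 0) -(scale0r (1 : B)) fZ mul0r.
by rewrite fD IH addr0 (f0 _ _ _ bi).
Qed.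

Section Phi.
Variable P : projRes S.

(* Unlike "internal degree n", this necessary condition for an n-cocycle to be
   generated by Ext^1 makes sense for an ungraded, non-minimal resolution. *)
Definition linear_cocycle n : (P n -> k) -> Prop :=
  match n with
  | 0 => fun f => exists c, forall x, f x = c * res_aug x
  | n'.+1 => fun f => forall x, in_aug2 (res_d P n' x) -> f x = 0
  end.

Lemma linear_cocycle_lin n c (f g : P n -> k) :
  linear_cocycle f -> linear_cocycle g ->
  linear_cocycle (fun x => c * f x + g x).
Proof.
case: n f g => [|n] f g.
  move=> [a fa] [b gb]; exists (c * a + b) => x.
  by rewrite fa gb mulrA mulrDl.
by move=> f0 g0 x x2; rewrite f0 // g0 // mulr0 addr0.
Qed.

Lemma linear_cocycle_eq n (f g : P n -> k) :
  f =1 g -> linear_cocycle f -> linear_cocycle g.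
Proof. by move=> /funext ->. Qed.

(** In degree one, let [d x] be a sum of terms [b c y] with [b], [c] in [B_+]. Each [c y] is some
    [d w], and [f] kills [b w]; so [x] differs from an element killed by [f] by a cycle, which is a
    boundary. A product [g o phi_m] inherits the property from [g], because [phi] is [B]-linear and
    commutes with [d]. A coboundary has it because a map to the trivial module kills [B_+ B_+ P]. *)
Lemma ext1_gen_linear n (f : P n -> k) : ext1_gen f -> linear_cocycle f.
Proof.
elim=> {n f} [|f [ft fd]|n c f g _ fP _ gP|m n g f h _ gP _ fP|n f g _ fP fg].
- by exists 1 => x; rewrite mul1r.
- have [fD _ f0] := ft.
  suff f2 (x : P 1%N) : in_aug2 (res_d P 0 x) -> f x = 0 by exact: f2.
  move=> x2.
  have [y [fy dy]] : exists y, f y = 0 /\ res_d P 0 y = res_d P 0 x.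
    elim: x2 => [|i j b c y z bi cj _ [y' [fy' <-]]].
      by exists 0; rewrite linear0 (to_triv_aug2 ft) //; constructor.
    have [w wE] : exists w, c *: y = res_d P 0 w.
      by apply/res_exact0; case: (res_aug_triv P) => _ _ /(_ _ _ _ cj).
    exists (b *: w + y'); rewrite fD fy' addr0 (f0 _ _ _ bi).
    by rewrite linearD linearZ /= wE.
  have /res_exact[w wE] : res_d P 0 (x - y) = 0 by rewrite linearB dy subrr.
  by rewrite -[x](subrK y) fD fy addr0 wE fd.
- exact: linear_cocycle_lin.
- move=> [phi [phi0 phid hE]]; case: m => [|m] in g h gP phi phi0 phid hE *.
    (* A factor of degree 0 is a multiple [c] of the unit; the product [c f] is written as
       [(c - 1) f + f]. *)
    move: gP => [c gc]; apply: linear_cocycle_eq (linear_cocycle_lin (c - 1) fP fP).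
    by move=> x; rewrite hE gc phi0 mulrBl mul1r subrK.
  move=> x x2; rewrite hE; apply: gP; rewrite phid; exact: in_aug2_lin.
- case: n f g fP fg => [|n] f g /=.
    move=> [c fc] fg; exists c => x.
    by rewrite -fc; apply/eqP; rewrite -subr_eq0 fg.
  move=> f0 [w wt gE] x x2.
  by rewrite -[g x](subrK (f x)) gE f0 // (to_triv_aug2 wt x2) addr0.
Qed.
End Phi.
End Koszul.

(** * Gradings *)

(** A connected grading: by [geps_part0] the component of degree 0 consists of scalars. Tensor
    algebras and their quadratic quotients both carry one, so the Koszul complex can be studied over
    an abstract [B]. *)
Record grading (k : fieldType) (T : algType k) := Grading {
  gpart : nat -> submodClosed T;
  gproj : nat -> {linear T -> T};
  geps : T -> k;
  gpartM : forall i j x y, x \in gpart i -> y \in gpart j -> x * y \in gpart (i + j)%N;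
  gproj_part : forall n x, gproj n x \in gpart n;
  gproj_id : forall n x, x \in gpart n -> gproj n x = x;
  gproj_neq : forall m n x, x \in gpart m -> m != n -> gproj n x = 0;
  gproj_sum : forall x, exists N, x = \sum_(n < N) gproj n x;
  geps_linear : forall c x y, geps (c *: x + y) = c * geps x + geps y;
  geps_part : forall n x, x \in gpart n.+1 -> geps x = 0;
  geps_part0 : forall x, x \in gpart 0 -> x = geps x *: 1;
  geps1 : geps 1 = 1 }.

Section Grading.
Variables (k : fieldType) (T : algType k) (G : grading T).

Lemma gprojMl i j b z : b \in gpart G i ->
  gproj G j (b * z) = if (i <= j)%N then b * gproj G (j - i)%N z else 0.
Proof.
move=> bi; have [N ->] := gproj_sum G z; rewrite mulr_sumr !linear_sum /= mulr_sumr.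
have h n : gproj G j (b * gproj G n z)
    = if (i <= j)%N then b * gproj G (j - i)%N (gproj G n z) else 0.
  have bz := gpartM bi (gproj_part G n z).
  case: leqP => ij; last first.
    by rewrite (gproj_neq bz) // neq_ltn (leq_trans ij) ?leq_addr ?orbT.
  have [e|ne] := eqVneq (i + n)%N j.
    by rewrite -e addKn (gproj_id bz) (gproj_id (gproj_part G n z)).
  rewrite (gproj_neq bz) // (gproj_neq (gproj_part G n z)) ?mulr0 //.
  by apply: contra ne => /eqP ->; rewrite subnKC.
by case: leqP h => _ h; [apply: eq_bigr | apply: big1] => n _; apply: h.
Qed.

Lemma gprojMr1 j b z : b \in gpart G 1%N ->
  gproj G j.+1 (z * b) = gproj G j z * b.
Proof.
move=> b1; have [N ->] := gproj_sum G z; rewrite mulr_suml !linear_sum /= mulr_suml.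
apply: eq_bigr => n _; have bz := gpartM (gproj_part G n z) b1.
rewrite addn1 in bz; have [e|ne] := eqVneq (n : nat) j.
  by rewrite -e (gproj_id bz) (gproj_id (gproj_part G n z)).
by rewrite (gproj_neq bz) ?eqSS // (gproj_neq (gproj_part G n z)) ?mul0r.
Qed.

Lemma geps0 : geps G 0 = 0.
Proof. by have := geps_linear G (-1) 0 0; rewrite scaler0 addr0 mulN1r addNr. Qed.

Lemma gepsD x y : geps G (x + y) = geps G x + geps G y.
Proof. by rewrite -[x]scale1r geps_linear mul1r scale1r. Qed.

Lemma gepsZ c x : geps G (c *: x) = c * geps G x.
Proof. by rewrite -[_ *: _]addr0 geps_linear geps0 addr0. Qed.

Lemma geps_sum (I : Type) (s : seq I) (F : I -> T) :
  geps G (\sum_(i <- s) F i) = \sum_(i <- s) geps G (F i).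
Proof. by apply: (big_morph (geps G)); [apply: gepsD | apply: geps0]. Qed.

Lemma gepsM n b z : b \in gpart G n.+1 -> geps G (b * z) = 0.
Proof.
move=> bn; have [N ->] := gproj_sum G z; rewrite mulr_sumr geps_sum big1 // => i _.
exact: geps_part (gpartM bn (gproj_part G i z)).
Qed.

Lemma gepsMr0 b z : geps G z = 0 -> geps G (b * z) = 0.
Proof.
move=> z0; have [N ->] := gproj_sum G b; rewrite mulr_suml geps_sum.
rewrite big1 // => -[[|i] iN] _ /=.
  by rewrite (geps_part0 (gproj_part G 0 b)) mulr_algl gepsZ z0 mulr0.
exact: gepsM (gproj_part G i.+1 b).
Qed.

Lemma geps_gproj n z : geps G z = 0 -> geps G (gproj G n z) = 0.
Proof.
case: n => [|n] z0; last exact: geps_part (gproj_part G n.+1 z).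
have [N zE] := gproj_sum G z; move: z0; rewrite {1}zE geps_sum.
case: N zE => [z0|N _]; first by rewrite z0 !big_ord0 linear0 geps0.
rewrite big_ord_recl big1 ?addr0 // => i _; exact: geps_part (gproj_part G i.+1 z).
Qed.

(** An element of the Koszul complex has finitely many nonzero values; splitting it into homogeneous
    parts needs one bound for all of them. *)
Lemma gproj_sum_uniform (s : seq T) :
  exists N, forall b, b \in s -> b = \sum_(n < N) gproj G n b.
Proof.
have big N N' b : (N <= N')%N -> b = \sum_(n < N) gproj G n b ->
    b = \sum_(n < N') gproj G n b.
  move=> NN' bE; rewrite {1}bE -!(big_mkord predT (fun n => gproj G n b)).
  rewrite [RHS](big_cat_nat (leq0n N) NN') /= [X in _ = _ + X](_ : _ = 0) ?addr0 //.
  rewrite big_nat_cond big1 // => i /andP[/andP[Ni _] _].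
  rewrite bE linear_sum big1 // => j _.
  by rewrite (gproj_neq (gproj_part G j b)) // neq_ltn (leq_trans _ Ni).
elim: s => [|b s [N NE]]; first by exists 0%N.
have [N' N'E] := gproj_sum G b; exists (maxn N N') => c; rewrite inE.
move=> /predU1P[->|/NE cE]; first exact: big (leq_maxr _ _) N'E.
exact: big (leq_maxl _ _) cE.
Qed.
End Grading.

Section Degree.
Variables (k : fieldType) (T : algType k) (G : grading T).

Definition deg_le n t := forall m, (n < m)%N -> gproj G m t = 0.

Lemma part_deg_le i n t : t \in gpart G i -> (i <= n)%N -> deg_le n t.
Proof.
by move=> ti i_n m nm; rewrite (gproj_neq ti) // neq_ltn (leq_ltn_trans i_n).
Qed.

Lemma deg_leW i n t : deg_le i t -> (i <= n)%N -> deg_le n t.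
Proof. by move=> ti i_n m nm; apply: ti; apply: leq_ltn_trans nm. Qed.

Lemma deg_le_lin n c t u : deg_le n t -> deg_le n u -> deg_le n (c *: t + u).
Proof. by move=> tn un m nm; rewrite linearP /= tn // un // scaler0 addr0. Qed.

Lemma deg_leB n t u : deg_le n t -> deg_le n u -> deg_le n (t - u).
Proof. by move=> tn un m nm; rewrite linearB /= tn // un // subr0. Qed.

Lemma deg_le_top n t : deg_le n.+1 t -> deg_le n (t - gproj G n.+1 t).
Proof.
move=> tn m; rewrite linearB leq_eqVlt => /predU1P[<-|nm] /=.
  by rewrite (gproj_id (gproj_part G n.+1 t)) subrr.
by rewrite (tn m nm) (gproj_neq (gproj_part G n.+1 t)) ?subr0 // neq_ltn nm.
Qed.

Lemma deg_le0 t : deg_le 0 t -> gproj G 0 t = t.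
Proof.
move=> t0; have [[|N] tE] := gproj_sum G t.
  by rewrite tE big_ord0 linear0.
by rewrite [RHS]tE big_ord_recl big1 ?addr0 // => i _; apply: t0.
Qed.

Lemma deg_le_span (P : submodClosed T) n t :
  (forall i, (i <= n)%N -> {subset gpart G i <= P}) -> deg_le n t -> t \in P.
Proof.
move=> PG tn; have [N ->] := gproj_sum G t; apply: rpred_sum => i _.
case: (leqP i n) => [i_n|/tn ->]; last exact: rpred0.
by apply: (PG i i_n); apply: gproj_part.
Qed.

Lemma gproj_deg_leM i j m t u : deg_le i t -> deg_le j u -> (i + j <= m)%N ->
  gproj G m (t * u) = if m == (i + j)%N then gproj G i t * gproj G j u else 0.
Proof.
move=> ti uj ijm; have [N tE] := gproj_sum G t.
have h n : gproj G m (gproj G n t * u) =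
    if n == i then if m == (i + j)%N then gproj G i t * gproj G j u else 0 else 0.
  have [->|ni] := eqVneq n i.
    rewrite (gprojMl _ _ (gproj_part G i t)) (leq_trans (leq_addr j i)) //.
    have [->|mij] := eqVneq m (i + j)%N; first by rewrite addKn.
    by rewrite uj ?mulr0 // ltn_subRL ltn_neqAle eq_sym mij.
  case: (ltngtP n i) ni => // [ni|ni] _; last by rewrite ti // mul0r linear0.
  rewrite (gprojMl _ _ (gproj_part G n t)); case: ifP => // nm.
  by rewrite uj ?mulr0 // ltn_subRL (leq_trans _ ijm) // ltn_add2r.
rewrite {1}tE mulr_suml linear_sum (eq_bigr _ (fun (n : 'I_N) _ => h n)) -big_mkcond /=.
have [iN|Ni] := ltnP i N; first by rewrite (big_pred1 (Ordinal iN)).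
rewrite big_pred0 => [|n]; last by rewrite ltn_eqF // (leq_trans _ Ni).
suff -> : gproj G i t = 0 by rewrite mul0r if_same.
rewrite tE linear_sum big1 // => n _.
by rewrite (gproj_neq (gproj_part G n t)) // ltn_eqF // (leq_trans _ Ni).
Qed.

Lemma deg_leM i j t u : deg_le i t -> deg_le j u -> deg_le (i + j) (t * u).
Proof.
by move=> ti uj m ijm; rewrite (gproj_deg_leM ti uj) ?gtn_eqF // ltnW.
Qed.

Lemma gproj_top_M i j t u : deg_le i t -> deg_le j u ->
  gproj G (i + j) (t * u) = gproj G i t * gproj G j u.
Proof. by move=> ti uj; rewrite (gproj_deg_leM ti uj) ?eqxx. Qed.
End Degree.

(** * Quotients by relations of degree two *)

Section GradedQuotient.
Variables (k : fieldType) (T : algType k) (G : grading T) (S : T -> Prop).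
Hypothesis S2 : forall s, S s -> s \in gpart G 2%N.
Local Notation B := (quotalg S).

Lemma ideal_homog_span x : x \in ideal S ->
  x \in linspan (fun y : T => exists i a s j b,
    [/\ a \in gpart G i, S s, b \in gpart G j & y = a * s * b]).
Proof.
move=> /asboolP; elim=> [|a s b {}x Ss _ IH]; first exact: rpred0.
apply: rpredD IH; have [N aE] := gproj_sum G a; have [N' bE] := gproj_sum G b.
rewrite aE bE sum_mul3; apply: rpred_sum => i _; apply: rpred_sum => j _.
by apply: mem_span; exists i, (gproj G i a), s, j, (gproj G j b); rewrite !gproj_part.
Qed.

Lemma gproj_ideal n x : x \in ideal S -> gproj G n x \in ideal S.
Proof.
move=> /ideal_homog_span /asboolP.
elim=> [|c _ y [i [a [s [j [b [ai Ss bj ->]]]]]] _ IH]; first by rewrite linear0 rpred0.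
rewrite linearP /=; apply: rpredD => //; apply: rpredZ.
have asb := gpartM (gpartM ai (S2 Ss)) bj.
have [e|/(gproj_neq asb) ->] := eqVneq (i + 2 + j)%N n; last exact: rpred0.
rewrite -e gproj_id //; apply/asboolP; rewrite -[a * s * b]addr0.
by apply: in_idealD => //; apply: in_ideal0.
Qed.

(** Every [a s b] has components in degrees at least 2 only. This yields the augmentation of the
    quotient and the injectivity of [U -> B]. *)
Lemma gproj_ideal_low n x : x \in ideal S -> (n < 2)%N -> gproj G n x = 0.
Proof.
move=> /ideal_homog_span /asboolP xI n2.
elim: xI => [|c _ y [i [a [s [j [b [ai Ss bj ->]]]]]] _ IH].
  exact: linear0.
rewrite linearP /= IH (gproj_neq (gpartM (gpartM ai (S2 Ss)) bj)) ?scaler0 ?addr0 //.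
by rewrite neq_ltn addnAC addn2 (leq_trans n2) ?orbT.
Qed.

Definition qproj_at n (b : B) : B := qpi S (gproj G n (qrepr b)).

Lemma qproj_atE n t : qproj_at n (qpi S t) = qpi S (gproj G n t).
Proof.
apply/qpiP; rewrite -linearB; apply: gproj_ideal.
by apply/qpiP; rewrite [LHS]qreprK.
Qed.

Lemma qproj_at_linear n : linear (qproj_at n).
Proof.
move=> c a b; case: (qpi_surj a) (qpi_surj b) => t -> [u ->].
by rewrite -linearP !qproj_atE !linearP.
Qed.
HB.instance Definition _ n :=
  GRing.isLinear.Build k B B _ (qproj_at n) (qproj_at_linear n).

Definition qeps (b : B) : k := geps G (qrepr b).

Lemma qepsE t : qeps (qpi S t) = geps G t.
Proof.
apply/eqP; rewrite -subr_eq0 addrC -mulN1r -geps_linear scaleN1r addrC.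
set u := _ - t; have uI : u \in ideal S by apply/qpiP; rewrite [LHS]qreprK.
have [N ->] := gproj_sum G u; rewrite geps_sum; apply/eqP/big1 => -[[|i] iN] _ /=.
  by rewrite gproj_ideal_low // geps0.
exact: (geps_part (gproj_part G i.+1 u)).
Qed.

Lemma qeps_linear c a b : qeps (c *: a + b) = c * qeps a + qeps b.
Proof.
case: (qpi_surj a) (qpi_surj b) => t -> [u ->].
by rewrite -linearP !qepsE geps_linear.
Qed.

Lemma qeps1 : qeps 1 = 1.
Proof. by rewrite (qepsE 1) geps1. Qed.

Lemma quot_oner_neq0 : (1 : B) != 0.
Proof.
apply/eqP => /(congr1 qeps); rewrite qeps1 -[0](linear0 (qpi S)) qepsE geps0.
by move/eqP; rewrite oner_eq0.
Qed.

(* The mention of S2, which ensures that the quotient is not zero, lets the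
   algebra structure be inferred. *)
Definition quot_alg : Type := let _ := S2 in B.
HB.instance Definition _ := GRing.PzRing.on quot_alg.
HB.instance Definition _ := GRing.Lmodule.copy quot_alg B.
HB.instance Definition _ :=
  GRing.PzSemiRing_isNonZero.Build quot_alg quot_oner_neq0.
HB.instance Definition _ :=
  GRing.LSemiModule_isLSemiAlgebra.Build k quot_alg (@qscaleAl k T S).
HB.instance Definition _ :=
  GRing.LSemiAlgebra_isSemiAlgebra.Build k quot_alg (@qscaleAr k T S).

Definition qpart_pred n : {pred quot_alg} :=
  fun b => `[< exists2 t, t \in gpart G n & b = qpi S t >].

Lemma qpartP n (b : quot_alg) :
  reflect (exists2 t, t \in gpart G n & b = qpi S t) (b \in qpart_pred n).
Proof. exact: asboolP. Qed.

Lemma qpart_submod n : submod_closed (qpart_pred n).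
Proof.
split=> [|c a b /qpartP[t tn ->] /qpartP[u un ->]]; apply/qpartP.
  by exists 0; rewrite ?rpred0 ?linear0.
by exists (c *: t + u); rewrite ?linearP // rpredD ?rpredZ.
Qed.
HB.instance Definition _ n :=
  GRing.isSubmodClosed.Build k quot_alg (qpart_pred n) (qpart_submod n).
Definition qpart n : submodClosed quot_alg := qpart_pred n.

Definition qproj_lin n : {linear quot_alg -> quot_alg} := qproj_at n.

Definition qgrading : grading quot_alg.
Proof.
exists qpart qproj_lin qeps.
- move=> i j a b /qpartP[t ti ->] /qpartP[u uj ->]; apply/qpartP.
  by exists (t * u); rewrite ?gpartM //; apply/esym/qpiM.
- by move=> n b; apply/qpartP; exists (gproj G n (qrepr b)); rewrite ?gproj_part.
- by move=> n b /qpartP[t tn ->]; rewrite /= qproj_atE gproj_id.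
- by move=> m n b /qpartP[t tm ->] mn; rewrite /= qproj_atE (gproj_neq tm) ?linear0.
- move=> b; case: (qpi_surj b) => t ->; case: (gproj_sum G t) => N tE; exists N.
  by rewrite {1}tE linear_sum; apply: eq_bigr => n _; rewrite /= qproj_atE.
- exact: qeps_linear.
- by move=> n b /qpartP[t tn ->]; rewrite qepsE (geps_part tn).
- by move=> b /qpartP[t t0 ->]; rewrite qepsE {1}(geps_part0 t0); apply: qpiZ.
- exact: qeps1.
Defined.
End GradedQuotient.

Section Component.
Variables (k : fieldType) (U : vectType k).
Local Notation T := (tensorAlg U).
Implicit Types t : T.

Lemma tpowP n t :
  reflect (forall m : {fmonom 'I_(\dim {:U})}, size m != n -> t@_m = 0)
    (t \in tpow U n).
Proof. exact: asboolP. Qed.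

Definition tcomp n t : T :=
  [malg m in msupp t => if size m == n then t@_m else 0].

Lemma tcompE n t (m : {fmonom 'I_(\dim {:U})}) :
  (tcomp n t)@_m = if size m == n then t@_m else 0.
Proof. by rewrite mcoeffE; case: msuppP => // _; case: ifP. Qed.

Lemma tcomp_is_linear n : linear (tcomp n).
Proof.
move=> c t u; apply/malgP=> m; rewrite !(mcoeffD, mcoeffZ, tcompE).
by case: ifP => _; rewrite ?mulr0 ?addr0.
Qed.
HB.instance Definition _ n :=
  GRing.isLinear.Build k T T _ (tcomp n) (tcomp_is_linear n).

Lemma tcomp_tpow n t : tcomp n t \in tpow U n.
Proof. by apply/tpowP => m /negbTE mn; rewrite tcompE mn. Qed.

Lemma tcomp_id n t : t \in tpow U n -> tcomp n t = t.
Proof.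
by move=> /tpowP tn; apply/malgP=> m; rewrite tcompE; case: eqVneq => // /tn ->.
Qed.

Lemma tcomp_neq m n t : t \in tpow U m -> m != n -> tcomp n t = 0.
Proof.
move=> /tpowP tm mn; apply/malgP=> w; rewrite tcompE mcoeff0.
by case: eqP => // wn; apply: tm; rewrite wn eq_sym.
Qed.

Lemma tcomp_sum t : exists N, t = \sum_(n < N) tcomp n t.
Proof.
exists (\max_(m <- msupp t) size m)%N.+1; apply/malgP=> m.
rewrite mcoeff_sum; have [mt|/mcoeff_outdom m0] := boolP (m \in msupp t).
  have mN : (size m < (\max_(m <- msupp t) size m)%N.+1)%N.
    by rewrite ltnS; apply: (@leq_bigmax_seq _ _ predT (fun m : {fmonom _} => size m)).
  rewrite (bigD1 (Ordinal mN)) //= tcompE eqxx big1 ?addr0 // => i iN.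
  rewrite tcompE ifN //; apply: contra iN => /eqP mi.
  by apply/eqP/val_inj.
by rewrite big1 // => i _; rewrite tcompE m0 if_same.
Qed.

Lemma fmonom_cons (I : choiceType) i (s : seq I) :
  FMonom (i :: s) = mmul (fmu i) (FMonom s).
Proof. by apply: val_inj => /=; rewrite fmM fmU. Qed.

Lemma monalgUM (c : k) (m m' : {fmonom 'I_(\dim {:U})}) :
  (<< 1 *g m >> : T) * << c *g m' >> = << c *g mmul m m' >>.
Proof. by rewrite malgM_def fgmulUU mul1r. Qed.

Lemma tpowU (c : k) (m : {fmonom 'I_(\dim {:U})}) :
  (<< c *g m >> : T) \in tpow U (size m).
Proof.
apply/tpowP => m' mm'; rewrite mcoeffU; case: eqP => [e|_]; last by rewrite mulr0n.
by rewrite e eqxx in mm'.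
Qed.

Lemma tpow_words n t : t \in tpow U n ->
  t \in linspan (fun x : T =>
    exists m : {fmonom 'I_(\dim {:U})}, size m = n /\ x = << m >>).
Proof.
move=> /tpowP tn; rewrite [t]monalgE; rewrite big_seq; apply: rpred_sum => m mt.
have -> : << t@_m *g m >> = t@_m *: << m >> :> T.
  apply/malgP=> m'; rewrite [RHS](mcoeffZ t@_m (<< m >> : T)).
  by rewrite !mcoeffU mulrnAr mulr1.
apply/rpredZ/mem_span; exists m; split=> //.
by apply/eqP; apply: contraTT mt => /tn m0; rewrite -mcoeff_neq0 m0 eqxx.
Qed.

Lemma tpowS n t : t \in tpow U n.+1 ->
  t \in linspan (fun x =>
    exists i (u : T), u \in tpow U n /\ x = (<< fmu i >> : T) * u).
Proof.
move=> /tpow_words /asboolP; elim=> [|c _ x [m [mn ->]] _ IH].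
  exact: rpred0.
apply: rpredD => //; apply/rpredZ/mem_span.
case: m mn => -[//|i s] [sn]; exists i, << FMonom s >>.
by rewrite monalgUM -fmonom_cons -sn; split=> //; apply: tpowU.
Qed.

Lemma tincl_tpow u : tincl u \in tpow U 1.
Proof.
apply: rpred_sum => i _; apply: rpredZ.
by have := tpowU 1 (fmu i); rewrite fmU.
Qed.

Lemma fmu_tincl i : << fmu i >> = tincl (bas i) :> T.
Proof.
have fr : free (vbasis {:U}) := basis_free (vbasisP _).
rewrite /tincl (bigD1 i) //= big1 => [|j ji].
  by rewrite addr0 /bas coord_free // eqxx scale1r.
by rewrite /bas coord_free // eq_sym (negbTE ji) scale0r.
Qed.

Lemma mcoeff_tincl i u : (tincl u)@_(fmu i) = coord (vbasis {:U}) i u.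
Proof.
rewrite mcoeff_sum (bigD1 i) //= big1 => [|j ji].
  by rewrite addr0 mcoeffZ mcoeffUU mulr1.
rewrite mcoeffZ mcoeffU; case: (fmu j =P fmu i) => [|_]; last by rewrite mulr0.
by move=> /(congr1 (@fmonom_val _)); rewrite !fmU => -[ij]; rewrite ij eqxx in ji.
Qed.

Definition tgrading : grading T.
Proof.
exists (tpow U) tcomp (fun t => t@_mone).
- exact: tpowM.
- exact: tcomp_tpow.
- exact: tcomp_id.
- exact: tcomp_neq.
- exact: tcomp_sum.
- by move=> c t u; rewrite mcoeffD mcoeffZ.
- by move=> n t /tpowP tn; rewrite tn // fm1.
- move=> t /tpowP t0; apply/malgP=> m; rewrite [RHS]mcoeffZ mcoeff1.
  case: (m =P mone) => [->|m1]; first by rewrite mulr1.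
  rewrite mulr0 t0 // size_eq0; apply/eqP => m0; apply: m1; apply: val_inj.
  by rewrite /= m0 fm1.
- by rewrite mcoeff1 eqxx.
Defined.
End Component.

Section QuadraticAlgebra.
Variables (k : fieldType) (U : vectType k) (S : tensorAlg U -> Prop).
Hypothesis S2 : forall s, S s -> s \in tpow U 2%N.
Local Notation T := (tensorAlg U).
Local Notation B := (quotalg S).

Lemma homogP n (b : B) :
  reflect (exists2 t, t \in tpow U n & b = qpi S t) (b \in homog S n).
Proof. exact: asboolP. Qed.

Lemma gen_homog u : gen S u \in homog S 1%N.
Proof. by apply/homogP; exists (tincl u); rewrite ?tincl_tpow. Qed.

Lemma gen_inj : injective (gen S).
Proof.
move=> u v uv; have uvI : tincl u - tincl v \in ideal S by apply/qpiP.
have uv1 : tincl u - tincl v \in tpow U 1 by rewrite rpredB ?tincl_tpow.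
have /subr0_eq tuv := etrans (esym (tcomp_id uv1))
  (@gproj_ideal_low k T (tgrading U) S S2 1 _ uvI isT).
rewrite (coord_vbasis (memvf u)) (coord_vbasis (memvf v)).
by apply: eq_bigr => i _; rewrite -!mcoeff_tincl tuv.
Qed.

Lemma homogS n b : b \in homog S n.+1 ->
  b \in linspan (fun x : B => exists u c, c \in homog S n /\ x = gen S u * c).
Proof.
move=> /homogP[t /tpowS /asboolP tn ->].
elim: tn => [|c _ y [i [u [un ->]]] _ IH]; first by rewrite linear0 rpred0.
rewrite linearP; apply: rpredD => //.
apply/rpredZ/mem_span; exists (bas i), (qpi S u); split.
  by apply/homogP; exists u.
by rewrite fmu_tincl; apply: qpiM.
Qed.

Lemma homog1P b : b \in homog S 1%N -> exists u, b = gen S u.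
Proof.
move=> /homogS /asboolP; elim=> [|c _ x [u [a [a0 ->]]] _ [v ->]].
  by exists 0; rewrite linear0.
exists ((c * geps (qgrading (G := tgrading U) S2) a) *: u + v).
have aE := @geps_part0 _ _ (qgrading (G := tgrading U) S2) a a0.
by rewrite linearP {1}aE -qscaleAr mulr1 scalerA.
Qed.
End QuadraticAlgebra.

(** * The Koszul complex *)

Section KoszulComplex.
Variables (k : fieldType) (B : algType k) (G : grading B).
Hypothesis gpart_gen : forall n b, b \in gpart G n.+1 ->
  b \in linspan (fun y : B =>
    exists u c, [/\ u \in gpart G 1%N, c \in gpart G n & y = u * c]).
Variables (r : nat) (x : 'I_r -> B).
Hypothesis x1 : forall a, x a \in gpart G 1%N.
Hypothesis x_free : forall c : 'I_r -> k,
  \sum_a c a *: x a = 0 -> forall a, c a = 0.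
Hypothesis x_gen : forall b, b \in gpart G 1%N ->
  exists c : 'I_r -> k, b = \sum_a c a *: x a.

Local Notation word := (seq 'I_r).

(* These functions are the linear forms on the free algebra on the dual basis
   that vanish on the ideal of relations of the quadratic dual of B. *)
Definition kills_relations (F : word -> k) : Prop :=
  forall w1 w2, \sum_a \sum_b F (w1 ++ a :: b :: w2) *: (x a * x b) = 0.

(* The term B (x) (B^!_m)^* of the Koszul complex, as functions on words. *)
Definition in_koszul m (f : word -> B) : Prop :=
  (forall w, size w != m -> f w = 0) /\
  forall l : {linear B -> k^o}, kills_relations (fun w => l (f w)).

Definition koszul_pred m : {pred (word -> B^o)} := fun f => `[< in_koszul m f >].

Lemma koszul_predP m f : reflect (in_koszul m f) (f \in koszul_pred m).
Proof. exact: asboolP. Qed.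

Lemma form_mull (l : {linear B -> k^o}) (b : B) :
  exists l' : {linear B -> k^o}, forall y, l' y = l (b * y).
Proof.
apply: (@linear_map_exists k B k^o) => c y z.
by rewrite mulrDr -scalerAr linearP.
Qed.

Lemma form_mulr (l : {linear B -> k^o}) (b : B) :
  exists l' : {linear B -> k^o}, forall y, l' y = l (y * b).
Proof.
apply: (@linear_map_exists k B k^o) => c y z.
by rewrite mulrDl -scalerAl linearP.
Qed.

Lemma koszul_submod m : submod_closed (koszul_pred m).
Proof.
split=> [|c f g /koszul_predP[f0 fK] /koszul_predP[g0 gK]]; apply/koszul_predP.
  split=> // l w1 w2; rewrite big1 // => a _; rewrite big1 // => b _.
  by rewrite [(0 : word -> B^o) _]/(0 : B) linear0 scale0r.
split=> [w wm|l w1 w2].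
  by rewrite -[LHS]/(c * f w + g w) f0 // g0 // mulr0; apply: addr0.
have [l' l'E] := form_mull l c.
transitivity (\sum_a \sum_b (l' (f (w1 ++ a :: b :: w2)) : k) *: (x a * x b)
  + \sum_a \sum_b (l (g (w1 ++ a :: b :: w2)) : k) *: (x a * x b)); last first.
  by rewrite -[RHS]addr0; congr (_ + _); [exact: fK l' w1 w2 | exact: gK l w1 w2].
rewrite -big_split; apply: eq_bigr => a _; rewrite -big_split; apply: eq_bigr => b _ /=.
by rewrite -[X in l X]/((c : B) * (f _ : B) + (g _ : B)) linearD l'E scalerDl.
Qed.
HB.instance Definition _ m :=
  GRing.isSubmodClosed.Build B (word -> B^o) (koszul_pred m) (koszul_submod m).
Definition koszul_sub m : submodClosed (word -> B^o) := koszul_pred m.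
Definition kmod m : lmodType B := submod (koszul_sub m).

Definition kval m (f : kmod m) : word -> B := submod_val f.

Arguments kval : simpl never.

Lemma kvalP m (f : kmod m) : in_koszul m (kval f).
Proof. exact/koszul_predP/submodP. Qed.

Definition kmk m (f : word -> B) (fK : in_koszul m f) : kmod m :=
  @Submod B (word -> B^o) (koszul_sub m) f (introT (koszul_predP m f) fK).

Lemma kval_inj m (f g : kmod m) : (forall w, kval f w = kval g w) -> f = g.
Proof. by move=> fg; apply: val_inj; apply/funext => w; apply: fg. Qed.

Lemma kvalD m (f g : kmod m) w : kval (f + g) w = kval f w + kval g w.
Proof. by rewrite /kval submod_valD. Qed.

Lemma kvalZ m b (f : kmod m) w : kval (b *: f) w = b * kval f w.
Proof. by rewrite /kval submod_valZ. Qed.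

Lemma kval_sum m (I : Type) (s : seq I) (F : I -> kmod m) w :
  kval (\sum_(i <- s) F i) w = \sum_(i <- s) kval (F i) w.
Proof. by apply: (big_morph (fun f : kmod m => kval f w)). Qed.

(** By hypothesis the tensor [sum f a b (x) x a x b] in [B (x) B] is killed by every [l (x) id],
    hence it is zero, and so is its image under multiplication. A finite dual basis for the values
    of [f] replaces the tensor product. *)
Lemma form_bilin (f : 'I_r -> 'I_r -> B) :
  (forall l : {linear B -> k^o}, \sum_a \sum_b (l (f a b) : k) *: (x a * x b) = 0) ->
  \sum_a \sum_b f a b * (x a * x b) = 0.
Proof.
move=> f0; have [ps psE] := finite_dual_basis (fun p : 'I_r * 'I_r => f p.1 p.2)
  (enum {: 'I_r * 'I_r}).
transitivity (\sum_(u <- ps) (\sum_(q <- u.2) q.1 *: f q.2.1 q.2.2) *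
    \sum_a \sum_b (u.1 (f a b) : k) *: (x a * x b)); last first.
  by apply: big1 => u _; rewrite f0 mulr0.
under [RHS]eq_bigr do rewrite mulr_sumr.
rewrite [RHS]exchange_big; apply: eq_bigr => a _ /=.
under [RHS]eq_bigr do rewrite mulr_sumr.
rewrite [RHS]exchange_big; apply: eq_bigr => b _ /=.
rewrite {1}(psE (a, b) (mem_enum _ _)) mulr_suml; apply: eq_bigr => u _ /=.
by rewrite -scalerAl -scalerAr.
Qed.

(** The factor [x a] multiplies on the right, which keeps the differential linear for the left
    action of [B]. *)
Definition kdiff (f : word -> B) : word -> B := fun w => \sum_a f (a :: w) * x a.

Lemma kdiff_koszul m f : in_koszul m.+1 f -> in_koszul m (kdiff f).
Proof.
move=> [f0 fK]; split=> [w wm|l w1 w2].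
  by rewrite /kdiff big1 // => a _; rewrite f0 ?mul0r.
transitivity (\sum_c \sum_a \sum_b
    (l (f (c :: w1 ++ a :: b :: w2) * x c) : k) *: (x a * x b)).
  rewrite [RHS]exchange_big; apply: eq_bigr => a _; rewrite [RHS]exchange_big.
  apply: eq_bigr => b _; rewrite /kdiff linear_sum scaler_suml.
  by apply: eq_bigr.
apply: big1 => c _; have [l' l'E] := form_mulr l (x c).
rewrite -[RHS](fK l' (c :: w1) w2); apply: eq_bigr => a _.
by apply: eq_bigr => b _; rewrite l'E.
Qed.

Lemma kdiff2 m f : in_koszul m.+2 f -> kdiff (kdiff f) = fun=> 0.
Proof.
move=> [_ fK]; apply/funext => w; rewrite /kdiff.
under eq_bigr do rewrite mulr_suml; rewrite exchange_big /=.
transitivity (\sum_a \sum_b f (a :: b :: w) * (x a * x b)).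
  by apply: eq_bigr => a _; apply: eq_bigr => b _; rewrite mulrA.
by apply: form_bilin => l; apply: (fK l [::] w).
Qed.

Definition kd_fun m (f : kmod m.+1) : kmod m := kmk (kdiff_koszul (kvalP f)).

Lemma kd_funE m (f : kmod m.+1) w :
  kval (kd_fun f) w = \sum_a kval f (a :: w) * x a.
Proof. by []. Qed.

Lemma kd_is_linear m : linear (@kd_fun m).
Proof.
move=> c f g; apply: kval_inj => w; rewrite kvalD kvalZ.
rewrite !kd_funE mulr_sumr -big_split; apply: eq_bigr => a _ /=.
by rewrite kvalD kvalZ mulrDl mulrA.
Qed.
HB.instance Definition _ m :=
  GRing.isLinear.Build B (kmod m.+1) (kmod m) _ (@kd_fun m) (@kd_is_linear m).
Definition kd m : {linear kmod m.+1 -> kmod m} := @kd_fun m.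

Lemma kdE m (f : kmod m.+1) w : kval (kd m f) w = \sum_a kval f (a :: w) * x a.
Proof. by []. Qed.

Lemma kd_kd m f : kd m (kd m.+1 f) = 0.
Proof.
apply: kval_inj => w; rewrite -[RHS]/(0 : B).
exact: (congr1 (fun h : word -> B => h w) (kdiff2 (kvalP f))).
Qed.

Section DualBasis.
Variable m : nat.

Definition killers := {F : word -> k | kills_relations F}.
(** The class of [w] in the quadratic dual, seen as a function on the forms that vanish on its
    relations. *)
Definition eval_at (w : word) : killers -> k^o := fun F => sval F w.

Lemma eval_at_relation (l : {linear B -> k^o}) w1 w2 :
  \sum_a \sum_b (l (x a * x b) : k) *: eval_at (w1 ++ a :: b :: w2) = 0.
Proof.
apply/funext => F; rewrite fct_sumE.
transitivity (l (\sum_a \sum_b sval F (w1 ++ a :: b :: w2) *: (x a * x b))).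
  rewrite linear_sum; apply: eq_bigr => a _.
  rewrite fct_sumE linear_sum; apply: eq_bigr => b _.
  by rewrite linearZ /=; apply: mulrC.
by rewrite (svalP F) linear0.
Qed.

Variable ps : seq ({linear (killers -> k^o) -> k^o} * seq (k * word)).
Hypothesis psE : forall w, size w = m ->
  eval_at w = \sum_(u <- ps) u.1 (eval_at w) *: \sum_(q <- u.2) q.1 *: eval_at q.2.

Definition dual_elt_fun (p : {linear (killers -> k^o) -> k^o}) : word -> B :=
  fun w => if size w == m then (p (eval_at w) : k) *: 1 else 0.

Lemma dual_elt_koszul p : in_koszul m (dual_elt_fun p).
Proof.
split=> [w /negbTE wm|l w1 w2]; first by rewrite /dual_elt_fun wm.
have [wm|wm] := eqVneq (size w1 + (size w2).+2)%N m; last first.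
  apply: big1 => a _; apply: big1 => b _.
  by rewrite /dual_elt_fun size_cat /= (negbTE wm) linear0 scale0r.
transitivity (l 1 *: \sum_a \sum_b
    (p (eval_at (w1 ++ a :: b :: w2)) : k) *: (x a * x b)).
  rewrite scaler_sumr; apply: eq_bigr => a _.
  rewrite scaler_sumr; apply: eq_bigr => b _.
  rewrite /dual_elt_fun size_cat /= wm eqxx scalerA linearZ /=.
  by congr (_ *: _); apply: mulrC.
rewrite [X in _ *: X](_ : _ = 0) ?scaler0 //; apply: linear_forms_eq => l'.
transitivity (p (\sum_a \sum_b (l' (x a * x b) : k) *: eval_at (w1 ++ a :: b :: w2))).
  rewrite !linear_sum; apply: eq_bigr => a _; rewrite !linear_sum.
  by apply: eq_bigr => b _; rewrite !linearZ /=; apply: mulrC.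
by rewrite eval_at_relation !linear0.
Qed.

Definition dual_elt p : kmod m := kmk (dual_elt_koszul p).

(** Composing [f] with a form [l] gives an element of [killers]. The expansion [psE] of [eval_at w],
    evaluated there, is the claim after applying [l], and forms separate points. *)
Lemma kmod_dual_basis (f : kmod m) :
  f = \sum_(u <- ps) (\sum_(q <- u.2) q.1 *: kval f q.2) *: dual_elt u.1.
Proof.
apply: kval_inj => w; rewrite kval_sum; case: (kvalP f) => f0 fK.
have [wm|wm] := eqVneq (size w) m; last first.
  rewrite f0 // big1 // => u _; rewrite kvalZ.
  by rewrite -[kval _ w]/(dual_elt_fun u.1 w) /dual_elt_fun (negbTE wm) mulr0.
apply: linear_forms_eq => l.
have := congr1 (fun h => h (exist _ _ (fK l))) (psE wm).
rewrite fct_sumE -[eval_at w _]/(l (kval f w)) => ->.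
rewrite linear_sum; apply: eq_bigr => u _; rewrite kvalZ.
rewrite -[kval (dual_elt _) w]/(dual_elt_fun u.1 w) /dual_elt_fun wm eqxx.
rewrite -scalerAr mulr1 linearZ; congr (_ * _); rewrite fct_sumE linear_sum.
by apply: eq_bigr => q _; rewrite linearZ.
Qed.

End DualBasis.

Lemma kmod_dual_basis_exists m :
  exists ps : seq ({linear (killers -> k^o) -> k^o} * seq (k * word)),
  forall f : kmod m,
    f = \sum_(u <- ps) (\sum_(q <- u.2) q.1 *: kval f q.2) *: dual_elt m u.1.
Proof.
have [ps psE] := finite_dual_basis eval_at [seq val t | t <- enum {: m.-tuple 'I_r}].
exists ps; apply: kmod_dual_basis => w wm; apply: psE.
by apply/mapP; exists (Tuple (introT eqP wm)); rewrite ?mem_enum.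
Qed.

(** The dual basis criterion: the coefficients in [kmod_dual_basis] are [B]-linear in the element,
    so lifting the images of the [dual_elt] suffices. *)
Lemma kmod_projective m : projective (kmod m).
Proof.
have [ps psE] := kmod_dual_basis_exists m => M N g f gsurj.
pose n p := projT1 (cid (gsurj (f (dual_elt m p)))).
have nE p : g (n p) = f (dual_elt m p) by rewrite /n; case: cid.
have [|F FE] := @linear_map_exists B (kmod m) M (fun h =>
    \sum_(u <- ps) (\sum_(q <- u.2) q.1 *: kval h q.2) *: n u.1).
  move=> c h h'; rewrite scaler_sumr -big_split; apply: eq_bigr => u _ /=.
  rewrite scalerA -scalerDl; congr (_ *: _); rewrite mulr_sumr -big_split.
  by apply: eq_bigr => q _ /=; rewrite kvalD kvalZ scalerDr scalerAr.
exists F => h; rewrite FE [in RHS](psE h) !linear_sum.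
by apply: eq_bigr => u _; rewrite !linearZ /= nE.
Qed.

(** In degree 0 the differential is the augmentation to [k], so that [exact_at 0] speaks of the
    augmented complex. *)
Definition in_cycles m : kmod m -> Prop :=
  match m with
  | 0 => fun f => geps G (kval f [::]) = 0
  | m'.+1 => fun f => kd m' f = 0
  end.

Definition cycle_pred m : {pred kmod m} := fun f => `[< in_cycles f >].

Lemma cycle_predP m (f : kmod m) : reflect (in_cycles f) (f \in @cycle_pred m).
Proof. exact: asboolP. Qed.

Lemma cycle_submod m : submod_closed (@cycle_pred m).
Proof.
split=> [|c f g /cycle_predP fZ /cycle_predP gZ]; apply/cycle_predP.
  by case: m => [|m]; [exact: geps0 | exact: linear0].
case: m f g fZ gZ => [|m] f g /= fZ gZ; last first.
  by rewrite linearP /= fZ gZ scaler0 addr0.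
by rewrite kvalD kvalZ gepsD gZ addr0 gepsMr0.
Qed.
HB.instance Definition _ m :=
  GRing.isSubmodClosed.Build B (kmod m) (@cycle_pred m) (@cycle_submod m).
Definition cycle_sub m : submodClosed (kmod m) := @cycle_pred m.
Definition zmod m : lmodType B := submod (cycle_sub m).
Definition zincl m : {linear zmod m -> kmod m} := (val : submod (cycle_sub m) -> _).

Lemma zinclP m (z : zmod m) : in_cycles (zincl m z).
Proof. exact/cycle_predP/submodP. Qed.

Lemma zincl_inj m : injective (zincl m).
Proof. exact: val_inj. Qed.

Lemma zmkP m (f : kmod m) : in_cycles f -> exists z, zincl m z = f.
Proof. by move=> /cycle_predP fZ; exists (@Submod _ _ (cycle_sub m) f fZ). Qed.

Definition zfun m (z : zmod m) : word -> B := kval (zincl m z).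

Lemma zfun_kdiff m (z : zmod m) w : \sum_a zfun z (a :: w) * x a = 0.
Proof.
case: m z => [|m] z; last first.
  by rewrite -[LHS](kdE (zincl _ z)) (zinclP z).
rewrite big1 // => a _; have [f0 _] := kvalP (zincl _ z).
by rewrite /zfun f0 ?mul0r.
Qed.

Lemma kd_in_cycles m (g : kmod m.+1) : in_cycles (kd m g).
Proof.
case: m g => [|m] g /=; last exact: kd_kd.
rewrite kdE geps_sum big1 // => a _; have [N ->] := gproj_sum G (kval g [:: a]).
rewrite mulr_suml geps_sum big1 // => i _.
by have := gpartM (gproj_part G i (kval g [:: a])) (x1 a); rewrite addn1 => /geps_part.
Qed.

Lemma kdz_exists m : exists d : {linear kmod m.+1 -> zmod m},
  forall g, zincl m (d g) = kd m g.
Proof.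
have [|d dE] := @linear_map_exists B (kmod m.+1) (zmod m) (fun g =>
    @Submod _ _ (cycle_sub m) (kd m g) (introT (cycle_predP _) (kd_in_cycles g))).
  by move=> c g h; apply: zincl_inj; rewrite [RHS]linearP; apply: linearP.
by exists d => g; rewrite dE.
Qed.

(** * Exactness of the Koszul complex *)

Definition exact_at m := forall f : kmod m, in_cycles f -> exists g, f = kd m g.

Section Splice.
Variable m : nat.
Hypothesis exm : exact_at m.
Variable Q : resolution (zmod m.+1).
Variable d : {linear kmod m.+1 -> zmod m}.
Hypothesis dE : forall g, zincl m (d g) = kd m g.

Definition splice_mod n : lmodType B := if n is n'.+1 then Q n' else kmod m.+1.

Definition splice_d n : {linear splice_mod n.+1 -> splice_mod n} :=
  match n return {linear splice_mod n.+1 -> splice_mod n} with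
  | 0 => zincl m.+1 \o raug Q
  | n'.+1 => rd Q n'
  end.

(** By exactness at [m], [kmod m.+1] maps onto the cycles [zmod m]; the kernel is [zmod m.+1], which
    [Q] resolves. *)
Definition splice : resolution (zmod m).
Proof.
exists splice_mod splice_d d.
- by case=> [|n]; [exact: kmod_projective | exact: rproj].
- move=> z; have [g gE] := exm (zinclP z).
  by exists g; apply: zincl_inj; rewrite dE gE.
- move=> g; split=> [dg|[y ->]]; last first.
    by apply: zincl_inj; rewrite dE linear0; apply: (zinclP (raug Q y)).
  have /zmkP[z zE] : @in_cycles m.+1 g by rewrite /= -dE dg linear0.
  by have [y yE] := raug_surj Q z; exists y; rewrite /= yE.
- case=> [|n] y; last exact: rexact.
  rewrite -rexact0 /=; split=> [y0|->]; last exact: (linear0 (zincl m.+1)).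
  by apply: zincl_inj; rewrite linear0.
Defined.
End Splice.

Definition triv_form (M : lmodType B) (f : M -> k) : Prop :=
  [/\ forall y z, f (y + z) = f y + f z,
      forall c y, f ((c *: (1 : B)) *: y) = c * f y
    & forall n (b : B) y, b \in gpart G n.+1 -> f (b *: y) = 0].

Local Notation in_aug2 := (in_aug2 (fun n => gpart G n)).

(** The form in which Koszulness enters: the conclusion of [ext1_gen_linear] for every cocycle of
    positive degree. *)
Definition linear_ext : Prop :=
  forall (P : nat -> lmodType B) (d : forall n, {linear P n.+1 -> P n})
    (e : P 0 -> k),
  triv_form e -> (forall n, projective (P n)) -> (forall c, exists y, e y = c) ->
  (forall y, e y = 0 <-> exists z, y = d 0 z) ->
  (forall n y, d n y = 0 <-> exists z, y = d n.+1 z) ->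
  forall n (f : P n.+1 -> k), triv_form f -> (forall y, f (d n.+1 y) = 0) ->
  forall y, in_aug2 (d n y) -> f y = 0.

(** The condition on the differential of [y] once [kmod m] is put in front of [Q]; for [n = 0] this
    differential is the composite [Q 0 -> zmod m -> kmod m]. *)
Definition aug2_boundary m (Q : resolution (zmod m)) n : Q n -> Prop :=
  match n with
  | 0 => fun y => in_aug2 (zincl m (raug Q y))
  | n'.+1 => fun y => in_aug2 (rd Q n' y)
  end.

Lemma kmod0_augmentation (f : kmod 0 -> k) :
  (forall g, f g = geps G (kval g [::])) ->
  triv_form f /\ forall c, exists y, f y = c.
Proof.
move=> fE; split=> [|c].
  split=> [y z|c y|n b y bn]; rewrite !fE ?kvalD ?kvalZ ?gepsD //.
    by rewrite mulr_algl gepsZ.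
  exact: gepsM bn.
have gK : in_koszul 0 (fun w => if w == [::] then c *: 1 else 0).
  split=> [[]//|l w1 w2]; rewrite big1 // => a _; rewrite big1 // => b _.
  by case: w1 => [|? ?]; rewrite /= linear0 scale0r.
by exists (kmk gK); rewrite fE -[kval _ _]/(c *: 1) gepsZ geps1 mulr1.
Qed.

Hypothesis Bext : linear_ext.

Lemma resolution_linear m (Q : resolution (zmod m)) n (f : Q n -> k) y :
  (forall i, (i < m)%N -> exact_at i) ->
  triv_form f -> (forall y, f (rd Q n y) = 0) -> aug2_boundary y -> f y = 0.
Proof.
elim: m Q n f y => [|m IH] Q n f y exm ft fd yb.
  pose P n : lmodType B := if n is n'.+1 then Q n' else kmod 0.
  pose dP n : {linear P n.+1 -> P n} :=
    match n return {linear P n.+1 -> P n} with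
    | 0 => zincl 0 \o raug Q
    | n'.+1 => rd Q n'
    end.
  pose e (g : P 0) := geps G (kval (g : kmod 0) [::]).
  have [et e_surj] := kmod0_augmentation (fun g => erefl (e g)).
  apply: (@Bext P dP e et _ e_surj _ _ n f ft fd y).
  - by case=> [|j]; [exact: kmod_projective | exact: rproj].
  - move=> g; split=> [/(@zmkP 0)[z <-]|[z ->]]; last exact: (zinclP (raug Q z)).
    by have [w <-] := raug_surj Q z; exists w.
  - case=> [|j] g; last exact: rexact.
    rewrite -rexact0 /=; split=> [g0|->]; last exact: (linear0 (zincl 0)).
    by apply: zincl_inj; rewrite linear0.
  - by case: n f y ft fd yb.
have [d dE] := kdz_exists m.
apply: (IH (splice (exm m (ltnSn m)) Q dE) n.+1 f y) => // [i im|].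
  by apply: exm; apply: ltnW.
by case: n f y ft fd yb.
Qed.

Lemma cycle_aug2 m (f : zmod m -> k) z :
  (forall i, (i < m)%N -> exact_at i) -> triv_form f ->
  in_aug2 (zincl m z) -> f z = 0.
Proof.
move=> exm [fD fZ f0] z2; pose Q := free_resolution (zmod m).
have [y yz] := raug_surj Q z; rewrite -yz.
apply: (@resolution_linear m Q 0 (fun y => f (raug Q y)) y exm).
- split=> [u v|c u|n b u bn]; rewrite (linearD, linearZ_LR) //; exact: f0 bn.
- move=> u; have -> : raug Q (rd Q 0 u) = 0 by apply/rexact0; exists u.
  by have := fZ 0 0; rewrite scaler0 mul0r.
- by rewrite /= yz.
Qed.

(** A linear form that vanishes on [B_+ Z_m] induces a [triv_form] on [Z_m], so [cycle_aug2] makes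
    it vanish at [z], and separation concludes. The span is taken among functions on words, which
    form a space over [k], whereas [zmod m] is given as a module over [B]. *)
Lemma cycle_aug1 m (z : zmod m) :
  (forall i, (i < m)%N -> exact_at i) -> in_aug2 (zincl m z) ->
  zfun z \in linspan (fun h : word -> B =>
    exists n b (y : zmod m), b \in gpart G n.+1 /\ h = zfun (b *: y)).
Proof.
move=> exm z2; apply: contrapT => /negP /separating_form[F [F0 /eqP]].
suff -> : F (zfun z) = 0 by rewrite eq_sym oner_eq0.
apply: (@cycle_aug2 m (fun y => F (zfun y)) z exm _ z2).
have zfD (y y' : zmod m) : zfun (y + y') = zfun y + zfun y'.
  by apply/funext => w; rewrite /zfun linearD kvalD.
split=> [y y'|c y|n b y bn]; first by rewrite zfD (linearD F).
  have -> : zfun ((c *: 1) *: y) = c *: zfun y.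
    by apply/funext => w; rewrite /zfun linearZ kvalZ mulr_algl.
  exact: (linearZ_LR F c (zfun y)).
by apply/F0/mem_span; exists n, b, y.
Qed.

Lemma kproj_koszul m j (f : kmod m) : in_koszul m (fun w => gproj G j (kval f w)).
Proof.
have [f0 fK] := kvalP f; split=> [w wm|l]; first by rewrite f0 ?linear0.
exact: (fK (l \o gproj G j)).
Qed.

Definition kproj m j (f : kmod m) : kmod m := kmk (kproj_koszul j f).

Lemma kprojE m j (f : kmod m) w : kval (kproj j f) w = gproj G j (kval f w).
Proof. by []. Qed.

Lemma kproj_cycle m j (f : kmod m) : in_cycles f -> in_cycles (kproj j f).
Proof.
case: m f => [|m] f; first by rewrite /= kprojE; apply: geps_gproj.
move=> fZ; apply: kval_inj => w; rewrite kdE.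
under eq_bigr do rewrite kprojE -gprojMr1 //.
by rewrite -linear_sum -kdE [kd m f]fZ linear0.
Qed.

(** The hypothesis says that [sum x c (x) y c] is zero in [B (x) B], where [y c] is the expression
    that has to vanish; the [x c] are independent. *)
Lemma coef_relations (F : word -> 'I_r -> k) :
  (forall l : {linear B -> k^o}, kills_relations (fun w => l (\sum_a F w a *: x a))) ->
  forall c, kills_relations (fun w => F w c).
Proof.
move=> FK c w1 w2; apply: linear_forms_eq => P; rewrite linear0.
pose y c := \sum_a \sum_b F (w1 ++ a :: b :: w2) c *: (x a * x b).
apply: (x_free (c := fun c => P (y c))); apply: linear_forms_eq => l.
have yE : \sum_c (l (x c) : k) *: y c = 0.
  rewrite -[RHS](FK l w1 w2).
  under eq_bigr => c' _ do rewrite scaler_sumr.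
  rewrite exchange_big; apply: eq_bigr => a _ /=.
  under eq_bigr => c' _ do rewrite scaler_sumr.
  rewrite exchange_big; apply: eq_bigr => b _ /=.
  rewrite linear_sum scaler_suml; apply: eq_bigr => c' _.
  by rewrite scalerA linearZ; congr (_ *: _); apply: mulrC.
transitivity (P (\sum_c (l (x c) : k) *: y c)); last by rewrite yE !linear0.
rewrite !linear_sum; apply: eq_bigr => c' _ /=.
by rewrite !linearZ; apply: mulrC.
Qed.

Lemma gpart2_aug2 j (M : lmodType B) b (y : M) :
  b \in gpart G j.+2 -> in_aug2 (b *: y).
Proof.
move=> /gpart_gen /asboolP; elim=> [|c s t [u [v [u1 vj ->]]] _ IH].
  by rewrite scale0r; constructor.
rewrite scalerDl scalerAl -scalerA.
by apply: (in_aug2D (i := 0) (j := j)) => //; apply: rpredZ.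
Qed.

Lemma in_aug2_add (M : lmodType B) (y z : M) :
  in_aug2 y -> in_aug2 z -> in_aug2 (y + z).
Proof.
move=> y2 z2; elim: y2 => [|i j b c u v bi cj _ IH]; first by rewrite add0r.
by rewrite -addrA; apply: in_aug2D bi cj IH.
Qed.

(** The coefficients in the dual basis expansion are combinations of values of [f], hence lie in
    [B_(j+2) = B_1 B_(j+1)]. *)
Lemma kmod_aug2 m j (f : kmod m) :
  (forall w, kval f w \in gpart G j.+2) -> in_aug2 f.
Proof.
move=> fj; have [ps psE] := kmod_dual_basis_exists m.
rewrite (psE f); elim: ps {psE} => [|u ps IH]; first by rewrite big_nil; constructor.
rewrite big_cons; apply: in_aug2_add => //; apply: (@gpart2_aug2 j).
by apply: rpred_sum => q _; apply: rpredZ.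
Qed.

(** The coefficient of [x a] in [z w] becomes the scalar value of [g] at [a :: w]. The relations on
    [g] at the first two letters are the cycle condition on [z]; those further right come from
    [coef_relations]. *)
Lemma linear_cycle_exact m (z : zmod m) :
  (forall w, zfun z w \in gpart G 1%N) -> exists g, zincl m z = kd m g.
Proof.
move=> z1; have [z0 zK] := kvalP (zincl m z).
pose c w := projT1 (cid (x_gen (z1 w))).
have cE w : zfun z w = \sum_a c w a *: x a by rewrite /c; case: cid.
pose g (w : word) : B := if w is a :: w' then c w' a *: 1 else 0.
have cK a : kills_relations (fun w => c w a).
  apply: coef_relations => l w1 w2; rewrite -[RHS](zK l w1 w2).
  by apply: eq_bigr => a' _; apply: eq_bigr => b' _; rewrite -cE.
have gK : in_koszul m.+1 g.
  split=> [[|a w] //= wm|l [|a w1] w2].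
  - rewrite (x_free (c := c w)) ?scale0r //.
    by rewrite -cE [LHS]z0.
  - transitivity (l 1 *: \sum_b zfun z (b :: w2) * x b); last first.
      by rewrite zfun_kdiff scaler0.
    rewrite exchange_big scaler_sumr; apply: eq_bigr => b _ /=.
    rewrite cE mulr_suml scaler_sumr; apply: eq_bigr => a _.
    by rewrite linearZ -scalerAl scalerA; congr (_ *: _); apply: mulrC.
  - transitivity (l 1 *: \sum_b \sum_b' c (w1 ++ b :: b' :: w2) a *: (x b * x b')).
      rewrite scaler_sumr; apply: eq_bigr => b _; rewrite scaler_sumr.
      apply: eq_bigr => b' _; rewrite linearZ scalerA.
      by congr (_ *: _); apply: mulrC.
    by rewrite cK scaler0.
exists (kmk gK); apply: kval_inj => w; rewrite kdE [LHS]cE.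
by apply: eq_bigr => a _; rewrite -[kval _ _]/(c w a *: 1) -scalerAl mul1r.
Qed.

Lemma homog_cycle_exact m j (z : zmod m) :
  (forall i, (i < m)%N -> exact_at i) ->
  (forall w, zfun z w \in gpart G j) -> exists g, zincl m z = kd m g.
Proof.
move=> exm; elim/ltn_ind: j z => -[|[|j]] IH z zj.
(* A cycle with scalar values is zero: by the augmentation if [m = 0], by independence of the [x a]
   otherwise. *)
- exists 0; rewrite linear0; apply: kval_inj => w.
  have [z0 _] := kvalP (zincl m z); rewrite -[RHS]/(0 : B).
  have [wm|/z0//] := eqVneq (size w) m; rewrite -[LHS]/(zfun z w) (geps_part0 (zj w)).
  case: m z zj w wm z0 {exm IH} => [|m] z zj [|a w] //= wm z0.
    by rewrite (zinclP z : geps G (zfun z [::]) = 0) scale0r.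
  rewrite (x_free (c := fun a => geps G (zfun z (a :: w)))) ?scale0r //.
  rewrite -[RHS](zfun_kdiff z w); apply: eq_bigr => b _.
  by rewrite [in RHS](geps_part0 (zj (b :: w))) mulr_algl.
- exact: linear_cycle_exact.
have /(cycle_aug1 exm) /asboolP zX : in_aug2 (zincl m z) by apply: (@kmod_aug2 m j).
suff [g gE] : exists g : kmod m.+1,
    forall w, gproj G j.+2 (zfun z w) = kval (kd m g) w.
  by exists g; apply: kval_inj => w; rewrite -gE gproj_id.
elim: zX => [|c h h' [n [b [y [bn ->]]]] _ [g gE]].
  exists 0 => w; transitivity (0 : B); first exact: (linear0 (gproj G j.+2)).
  by rewrite (linear0 (kd m)).
(* The component of [b y] in degree [j.+2] only involves that of [y] in degree [j.+2 - n.+1], a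
   cycle of smaller internal degree; it is zero when [b] has degree above [j.+2]. *)
have [y' y'E] := zmkP (kproj_cycle (j.+2 - n.+1)%N (zinclP y)).
have [g' g'E] : exists g' : kmod m.+1, forall w,
    gproj G j.+2 (b * zfun y w) = kval (kd m g') w.
  case: (leqP n.+1 j.+2) => nj; last first.
    by exists 0 => w; rewrite (linear0 (kd m)) (gprojMl _ _ bn) leqNgt nj.
  have [|w|g' g'E] := IH (j.+2 - n.+1)%N _ y'.
  - by rewrite subSS ltnS (leq_trans (leq_subr _ _)).
  - by rewrite /zfun y'E kprojE gproj_part.
  exists (b *: g') => w; rewrite linearZ kvalZ -g'E y'E kprojE.
  by rewrite (gprojMl _ _ bn) nj.
exists ((c *: 1 : B) *: g' + g) => w.
rewrite (linearP (kd m)) kvalD kvalZ -gE -g'E mulr_algl -(linearP (gproj _ _)).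
have <- : zfun (b *: y) w = b * zfun y w.
  by rewrite /zfun (linearZ_LR (zincl m)) kvalZ.
by [].
Qed.

Lemma koszul_exact m : exact_at m.
Proof.
elim/ltn_ind: m => m exm f fZ.
have [N NE] := gproj_sum_uniform G [seq kval f (val t) | t <- enum {: m.-tuple 'I_r}].
have fE : f = \sum_(j < N) kproj j f.
  apply: kval_inj => w; rewrite kval_sum.
  have [wm|wm] := eqVneq (size w) m.
    apply: NE; apply/mapP; exists (Tuple (introT eqP wm)) => //.
    by rewrite mem_enum.
  have [f0 _] := kvalP f; rewrite f0 // big1 // => j _.
  by rewrite kprojE f0 // linear0.
have ex j : exists g, kproj j f = kd m g.
  have [z zE] := zmkP (kproj_cycle j fZ).
  have [|g gE] := @homog_cycle_exact m j z exm; last by exists g; rewrite -zE.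
  by move=> w; rewrite /zfun zE kprojE gproj_part.
exists (\sum_(j < N) projT1 (cid (ex j))); rewrite {1}fE linear_sum.
by apply: eq_bigr => j _; case: cid.
Qed.

(** Exactness in the coordinates in which forms are extended: only the component of degree 1 of a
    preimage matters, and [c] collects its coefficients. *)
Lemma quadratic_cycle_boundary m (f : word -> B) :
  in_koszul m f -> (forall w, f w \in gpart G 2%N) ->
  (forall w, \sum_a f (a :: w) * x a = 0) ->
  exists c : word -> 'I_r -> k, [/\ forall w, size w != m.+1 -> forall a, c w a = 0,
    forall a, kills_relations (fun w => c w a)
    & forall w, f w = \sum_a \sum_b c (a :: w) b *: (x b * x a)].
Proof.
move=> fK f2 fd; pose f' := kmk fK.
have f'E w : kval f' w = f w by [].
have fZ : in_cycles f'.
  case: m fK @f' f'E => [|m] fK f' f'E /=; first by rewrite f'E (geps_part (f2 _)).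
  by apply: kval_inj => w; rewrite kdE; apply: (fd w).
have [g gE] := koszul_exact fZ; pose h := kproj 1 g.
have h1 w : kval h w \in gpart G 1%N by rewrite kprojE gproj_part.
pose c w := projT1 (cid (x_gen (h1 w))).
have cE w : kval h w = \sum_a c w a *: x a by rewrite /c; case: cid.
have [h0 hK] := kvalP h; exists c; split=> [w wm a|a|w].
- by apply: (x_free (c := c w)); rewrite -cE h0.
- apply: coef_relations => l w1 w2; rewrite -[RHS](hK l w1 w2).
  by apply: eq_bigr => a' _; apply: eq_bigr => b' _; rewrite -cE.
rewrite -(gproj_id (f2 w)) -f'E gE kdE linear_sum; apply: eq_bigr => a _ /=.
rewrite gprojMr1 // -kprojE -/h cE mulr_suml; apply: eq_bigr => b _.
by rewrite scalerAl.
Qed.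

End KoszulComplex.

(** * Extension of linear forms *)

Section Extension.
Variables (k : fieldType) (B : algType k) (G : grading B) (r : nat) (x : 'I_r -> B).
Variables (d : {linear B -> B}) (h : B).
Local Notation word := (seq 'I_r).
Hypothesis x1 : forall a, x a \in gpart G 1%N.
Hypothesis dx2 : forall a, d (x a) \in gpart G 2%N.
Hypothesis h2 : h \in gpart G 2%N.
Hypothesis dxx : forall a b, d (x a * x b) = d (x a) * x b - x a * d (x b).
Hypothesis ddx : forall a, d (d (x a)) = h * x a - x a * h.
Hypothesis dh : d h = 0.
Hypothesis boundary : forall m (f : word -> B),
  in_koszul x m f -> (forall w, f w \in gpart G 2%N) ->
  (forall w, \sum_a f (a :: w) * x a = 0) ->
  exists c : word -> 'I_r -> k, [/\ forall w, size w != m.+1 -> forall a, c w a = 0,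
    forall a, kills_relations x (fun w => c w a)
    & forall w, f w = \sum_a \sum_b c (a :: w) b *: (x b * x a)].

(* The monomials of the inhomogeneous relation [sum_t rel_word t (x) rel_coef t]
   in T(V) (x) B_2: its contractions with p : B_2 -> k are the defining
   relations p + phi(p) + h(p) of A(Psi). *)
Definition rel_index : finType := ('I_r * 'I_r + ('I_r + 'I_1))%type.
Definition rel_word (t : rel_index) : word :=
  match t with inl p => [:: p.1; p.2] | inr (inl a) => [:: a] | inr (inr _) => [::] end.

Lemma rel_index_sum (M : nmodType) (F : rel_index -> M) :
  \sum_t F t = \sum_a \sum_b F (inl (a, b)) + \sum_a F (inr (inl a))
    + F (inr (inr ord0)).
Proof.
rewrite big_sumType /= big_sumType big_ord1 /= addrA; congr (_ + _ + _).
by rewrite pair_bigA; apply: eq_bigr => -[].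
Qed.

Definition rel_coef (t : rel_index) : B :=
  match t with inl p => x p.1 * x p.2 | inr (inl a) => d (x a) | inr (inr _) => h end.

(* F, a linear form on T(V), vanishes on w1 R w2 for all relations R when the
   following is zero. *)
Definition rel_at (F : word -> k) (w1 w2 : word) : B :=
  \sum_t F (w1 ++ rel_word t ++ w2) *: rel_coef t.

Lemma rel_atE F w1 w2 : rel_at F w1 w2 =
  \sum_a \sum_b F (w1 ++ a :: b :: w2) *: (x a * x b)
  + (F (w1 ++ w2) *: h + \sum_a F (w1 ++ a :: w2) *: d (x a)).
Proof.
rewrite /rel_at big_sumType /=; congr (_ + _); first by rewrite pair_bigA.
by rewrite big_sumType big_ord1 addrC.
Qed.

Lemma rel_at_part2 F w1 w2 : rel_at F w1 w2 \in gpart G 2%N.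
Proof.
apply: rpred_sum => -[p|[a|i]] _; apply: rpredZ => //=.
exact: (gpartM (x1 p.1) (x1 p.2)).
Qed.

Lemma eq_rel_at n (F F' : word -> k) w1 w2 :
  (forall w, (size w <= n)%N -> F' w = F w) -> (size w1 + size w2 + 2 <= n)%N ->
  rel_at F' w1 w2 = rel_at F w1 w2.
Proof.
move=> FF' wn; apply: eq_bigr => t _; rewrite FF' // !size_cat.
apply: leq_trans wn; rewrite addnCA [(size w1 + _ + _)%N]addnC leq_add2r.
by case: t => [p|[a|i]].
Qed.

(* Contract the relation at two places in either order. *)
Lemma rel_at_exchange (l : {linear B -> k^o}) F w1 w2 :
  \sum_t (l (rel_at F [::] (w1 ++ rel_word t ++ w2)) : k) *: rel_coef t
  = \sum_t (l (rel_coef t) : k) *: rel_at F (rel_word t ++ w1) w2.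
Proof.
transitivity (\sum_t \sum_s (F (rel_word s ++ w1 ++ rel_word t ++ w2)
    * (l (rel_coef s) : k)) *: rel_coef t).
  apply: eq_bigr => t _; rewrite /rel_at linear_sum scaler_suml.
  by apply: eq_bigr => s _; rewrite linearZ.
rewrite exchange_big; apply: eq_bigr => s _ /=.
rewrite /rel_at scaler_sumr; apply: eq_bigr => t _.
by rewrite scalerA mulrC !catA.
Qed.

(* Dual to the Jacobi identity for the relations of A(Psi). *)
Lemma rel_at_leibniz F w :
  \sum_c rel_at F [::] (c :: w) * x c
  = \sum_a x a * rel_at F [:: a] w + d (rel_at F [::] w).
Proof.
pose X c := \sum_a \sum_b F [:: a, b, c & w] *: (x a * x b * x c).
pose DR c := \sum_a F [:: a, c & w] *: (d (x a) * x c).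
pose DL a := \sum_c F [:: a, c & w] *: (x a * d (x c)).
have -> : \sum_c rel_at F [::] (c :: w) * x c =
    \sum_c X c + (\sum_c F (c :: w) *: (h * x c) + \sum_c DR c).
  rewrite -!big_split; apply: eq_bigr => c _ /=.
  rewrite rel_atE !mulrDl -scalerAl /X /DR !mulr_suml; congr (_ + (_ + _)).
    apply: eq_bigr => a _; rewrite mulr_suml; apply: eq_bigr => b _.
    by rewrite -scalerAl.
  by apply: eq_bigr => a _; rewrite -scalerAl.
have -> : \sum_a x a * rel_at F [:: a] w =
    \sum_c X c + (\sum_c F (c :: w) *: (x c * h) + \sum_a DL a).
  have -> : \sum_c X c = \sum_a \sum_b \sum_c F [:: a, b, c & w] *: (x a * x b * x c).
    by rewrite exchange_big; apply: eq_bigr => a _; rewrite exchange_big.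
  rewrite -!big_split; apply: eq_bigr => a _ /=.
  rewrite rel_atE !mulrDr -scalerAr /DL !mulr_sumr; congr (_ + (_ + _)).
    apply: eq_bigr => b _; rewrite mulr_sumr; apply: eq_bigr => c _.
    by rewrite -scalerAr mulrA.
  by apply: eq_bigr => c _; rewrite -scalerAr.
have -> : d (rel_at F [::] w) = (\sum_c DR c - \sum_a DL a)
    + (\sum_c F (c :: w) *: (h * x c) - \sum_c F (c :: w) *: (x c * h)).
  rewrite rel_atE !linearD linearZ /= dh scaler0 add0r; congr (_ + _).
    rewrite [\sum_c DR c]exchange_big -sumrB linear_sum; apply: eq_bigr => a _ /=.
    rewrite -sumrB linear_sum; apply: eq_bigr => b _ /=.
    by rewrite linearZ /= dxx scalerBr.
  rewrite -sumrB linear_sum; apply: eq_bigr => c _ /=.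
  by rewrite linearZ /= ddx scalerBr.
rewrite -addrA; congr (_ + _).
set p := \sum_c _ *: (h * x c); set q := \sum_c DR c.
set u := \sum_c _ *: (x c * h); set v := \sum_c DL c.
by rewrite [q - v + _]addrACA -opprD [v + u]addrC addrCA subrr addr0 addrC.
Qed.

(** The induction hypothesis for [F (a :: _)], for each first letter [a], settles all relations away
    from the left end. Those at the left end in total degree [n] form the obstruction. The
    correction [C] lives on words of length [n]; with its first letter fixed it kills the quadratic
    relations, so what is settled stays so. *)
Lemma extend_step n F :
  (forall w1 w2, (size w1 + size w2 + 2 < n)%N -> rel_at F w1 w2 = 0) ->
  exists F', (forall w, (size w < n)%N -> F' w = F w) /\
    forall w1 w2, (size w1 + size w2 + 2 <= n)%N -> rel_at F' w1 w2 = 0.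
Proof.
elim: n F => [|n IH] F F0.
  by exists F; split=> // w1 w2; rewrite addn2.
have ex a : exists F', (forall w, (size w < n)%N -> F' w = F (a :: w)) /\
    forall w1 w2, (size w1 + size w2 + 2 <= n)%N -> rel_at F' w1 w2 = 0.
  by apply: IH => w1 w2 wn; apply: (F0 (a :: w1) w2); rewrite !addSn ltnS.
pose F1 (w : word) : k := if w is a :: w' then projT1 (cid (ex a)) w' else F [::].
have F1F w : (size w <= n)%N -> F1 w = F w.
  by case: w => [//|a w] /=; case: cid => Fa [FaF _] /=; apply: FaF.
have F1cons a w1 w2 : (size w1 + size w2 + 2 <= n)%N -> rel_at F1 (a :: w1) w2 = 0.
  by rewrite /rel_at /=; case: cid => Fa [_ Fa0] /= wn; apply: Fa0.
have F1low w1 w2 : (size w1 + size w2 + 2 <= n)%N -> rel_at F1 w1 w2 = 0.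
  by move=> wn; rewrite (eq_rel_at F1F wn) F0.
case: n => [|m] in IH F0 ex F1 F1F F1cons F1low *.
  exists F1; split=> [w|w1 w2]; [by rewrite ltnS; apply: F1F | by rewrite addn2].
(* The obstruction is cut down to words of length [m], as [in_koszul m] demands; on shorter words
   the relation holds already. *)
pose f (w : word) : B := if size w == m then rel_at F1 [::] w else 0.
have fE w : (size w <= m)%N -> f w = rel_at F1 [::] w.
  rewrite /f leq_eqVlt; case: eqP => //= _ wm.
  by rewrite F1low //= add0n addn2.
have f2 w : f w \in gpart G 2%N.
  by rewrite /f; case: ifP => _; rewrite ?rpred0 ?rel_at_part2.
have fK : in_koszul x m f.
  split=> [w /negbTE wm|l w1 w2]; first by rewrite /f wm.
  have [wm|wm] := eqVneq (size w1 + (size w2).+2)%N m; last first.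
    apply: big1 => a _; apply: big1 => b _.
    by rewrite /f size_cat /= (negbTE wm) linear0 scale0r.
  (* Every relation on the right is away from the left end or of lower degree, hence settled. On the
     left, the linear and constant monomials lead to lower degree, so only the quadratic part
     remains. *)
  have := rel_at_exchange l F1 w1 w2; rewrite [RHS]big1 => [|t _]; last first.
    suff -> : rel_at F1 (rel_word t ++ w1) w2 = 0 by rewrite scaler0.
    case: t => [[a b]|[a|i]] /=.
    - by apply: F1cons; rewrite /= -wm !addSn !addnS addn0.
    - by apply: F1low; rewrite /= -wm !addSn !addnS addn0.
    - by apply: F1low; rewrite -wm !addnS addn0.
  rewrite big_sumType /= [X in _ + X]big1 ?addr0 => [|t _]; last first.
    suff -> : rel_at F1 [::] (w1 ++ rel_word (inr t) ++ w2) = 0.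
      by rewrite linear0 scale0r.
    apply: F1low; rewrite /= add0n addn2 !size_cat ltnS -wm.
    by case: t => [a|i] /=; rewrite ?add0n ?add1n !addnS // ltnW.
  move=> e; rewrite -[RHS]e pair_bigA; apply: eq_bigr => -[a b] _ /=.
  by rewrite fE // size_cat /= wm.
have fd w : \sum_a f (a :: w) * x a = 0.
  have [wm|wm] := eqVneq (size w).+1 m; last first.
    by rewrite big1 // => a _; rewrite /f /= (negbTE wm) mul0r.
  transitivity (\sum_a rel_at F1 [::] (a :: w) * x a).
    by apply: eq_bigr => a _; rewrite fE /= ?wm.
  (* On the right of this identity, the first sum is away from the left end and the last term is of
     lower degree. *)
  rewrite rel_at_leibniz F1low ?linear0 ?addr0; last by rewrite add0n addn2 wm.
  by rewrite big1 // => a _; rewrite F1cons ?mulr0 // add0n addn2 wm.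
have [c [c0 cK fc]] := boundary fK f2 fd.
pose C (w : word) : k := if w is b :: w' then c w' b else 0.
have C0 w : (size w <= m.+1)%N -> C w = 0.
  by case: w => [//|b w] /= wm; rewrite c0 // neq_ltn wm.
exists (fun w => F1 w - C w); split=> [w wm|w1 w2 wm].
  by rewrite C0 ?subr0 ?F1F.
have -> : rel_at (fun w => F1 w - C w) w1 w2 = rel_at F1 w1 w2 - rel_at C w1 w2.
  by rewrite -sumrB; apply: eq_bigr => t _; rewrite scalerBl.
case: w1 wm => [|b w1] /= wm; last first.
  rewrite F1cons; last by rewrite -ltnS.
  rewrite (rel_atE C) cK add0r C0 ?scale0r ?add0r; last first.
    by rewrite /= size_cat -ltnS (leq_trans _ wm) // addn2 addSn ltnW.
  rewrite big1 ?oppr0 ?addr0 // => a _.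
  by rewrite C0 ?scale0r //= size_cat /= addnS -ltnS (leq_trans _ wm) // addn2 addSn.
rewrite (rel_atE C) C0 /=; last by rewrite ltnW // -ltnS -(addn2 (size w2)).
rewrite scale0r add0r [X in _ - (_ + X)]big1 ?addr0 => [|a _]; last first.
  by rewrite c0 ?scale0r // neq_ltn -ltnS -addn2 wm.
rewrite exchange_big -fc fE ?subrr //.
by rewrite -ltnS -ltnS -addn2.
Qed.

Lemma extend n F N :
  (forall w1 w2, (size w1 + size w2 + 2 <= n)%N -> rel_at F w1 w2 = 0) ->
  exists F', (forall w, (size w <= n)%N -> F' w = F w) /\
    forall w1 w2, (size w1 + size w2 + 2 <= n + N)%N -> rel_at F' w1 w2 = 0.
Proof.
move=> F0; elim: N => [|N [F' [F'F F'0]]]; first by exists F; rewrite addn0.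
have [|F'' [F''F F''0]] := @extend_step (n + N).+1 F'.
  by move=> w1 w2; rewrite ltnS; apply: F'0.
exists F''; rewrite addnS; split=> // w wn.
by rewrite F''F ?F'F // ltnS (leq_trans wn) ?leq_addr.
Qed.

(** The start is [F] on words of length [n] and zero elsewhere: a relation of total degree at most
    [n] reaches such words only through its quadratic part, which [F] kills. *)
Lemma extend_top n (F : word -> k) N : kills_relations x F ->
  exists F', [/\ forall w, size w = n -> F' w = F w,
    forall w, (size w < n)%N -> F' w = 0
    & forall w1 w2, (size w1 + size w2 + 2 <= N)%N -> rel_at F' w1 w2 = 0].
Proof.
move=> FK; pose F0 w := if size w == n then F w else 0.
have [w1 w2 wn|F' [F'F F'0]] := @extend n F0 N.
  rewrite rel_atE /F0 !size_cat /= ifN; last first.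
    by rewrite neq_ltn (leq_trans _ wn) ?addn2.
  rewrite scale0r add0r [X in _ + X]big1 ?addr0 => [|a _]; last first.
    by rewrite size_cat /= ifN ?scale0r // neq_ltn addnS -addn2 wn.
  have [e|/negbTE ne] := eqVneq (size w1 + (size w2).+2)%N n.
    rewrite -[RHS](FK w1 w2); apply: eq_bigr => a _; apply: eq_bigr => b _.
    by rewrite size_cat /= e eqxx.
  by rewrite big1 // => a _; rewrite big1 // => b _; rewrite size_cat /= ne scale0r.
exists F'; split=> [w wn|w wn|w1 w2 wN].
- by rewrite F'F ?wn // /F0 wn eqxx.
- by rewrite (F'F _ (ltnW wn)) /F0 (ltn_eqF wn).
- by apply: F'0; apply: leq_trans wN (leq_addl _ _).
Qed.
End Extension.

(** * The algebra of a CDG-algebra *)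

Section TensorForms.
Variables (k : fieldType) (V : vectType k).
Local Notation T := (tensorAlg V).
Local Notation r := (\dim {:V}).

Definition tword (w : seq 'I_r) : T := << FMonom w >>.

Lemma tword_nil : tword [::] = 1.
Proof. by rewrite /tword; congr (<< _ >>); apply: val_inj; rewrite /= fm1. Qed.

Lemma tword_cat w1 w2 : tword (w1 ++ w2) = tword w1 * tword w2.
Proof.
by rewrite /tword monalgUM; congr (<< _ >>); apply: val_inj; rewrite /= fmM.
Qed.

Lemma tword1 a : tword [:: a] = tincl (bas a).
Proof.
by rewrite -fmu_tincl /tword; congr (<< _ >>); apply: val_inj; rewrite /= fmU.
Qed.

Lemma tword2 a b : tword [:: a; b] = << word2 a b >>.
Proof.
by rewrite /tword; congr (<< _ >>); apply: val_inj; rewrite /= fmM !fmU.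
Qed.

Lemma tpow_tword n t : t \in tpow V n ->
  t \in linspan (fun y : T => exists w, size w = n /\ y = tword w).
Proof.
move=> /tpow_words /asboolP; elim=> [|c _ u [[w] [wn ->]] _ IH]; first exact: rpred0.
by rewrite rpredD ?rpredZ //; apply: mem_span; exists w.
Qed.

Lemma form_of_words (F : seq 'I_r -> k) :
  exists f : {linear T -> k^o}, forall w, f (tword w) = F w.
Proof.
pose n (m : {fmonom 'I_r}) : k^o := F m.
have [c t u|f fE] := @linear_form_exists k T (fun t => frlift n t).
  have -> : c *: t = frscale c t :> freemod k {fmonom 'I_r}.
    by apply/malgP=> m; rewrite frscaleE; apply: mcoeffZ.
  exact: (frlift_is_linear n c t u).
by exists f => w; rewrite fE; apply: frliftU.
Qed.

Lemma tpow_form_eq n (f g : {linear T -> k^o}) t :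
  (forall w, size w = n -> f (tword w) = g (tword w)) -> t \in tpow V n -> f t = g t.
Proof.
move=> fg /tpow_tword /asboolP; elim=> [|c _ u [w [wn ->]] _ IH].
  by rewrite !linear0.
by rewrite !linearP fg // IH.
Qed.
End TensorForms.

Section Pairing.
Variables (k : fieldType) (U : vectType k).

Lemma pair2_linr (q : tensorAlg (dual U)) c (t u : tensorAlg U) :
  pair2 q (c *: t + u) = c * pair2 q t + pair2 q u.
Proof.
rewrite /pair2 mulr_sumr -big_split; apply: eq_bigr => a _.
rewrite mulr_sumr -big_split; apply: eq_bigr => b _.
rewrite mulr_sumr -big_split; apply: eq_bigr => i _.
rewrite mulr_sumr -big_split; apply: eq_bigr => j _ /=.
by rewrite mcoeffD mcoeffZ mulrDr mulrDl (mulrCA _ c) -!mulrA.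
Qed.

Lemma pair2_tpow (q : tensorAlg (dual U)) n (t : tensorAlg U) :
  t \in tpow U n -> n != 2%N -> pair2 q t = 0.
Proof.
move=> /tpowP tn n2; rewrite /pair2 big1 // => a _; rewrite big1 // => b _.
rewrite big1 // => i _; rewrite big1 // => j _.
by rewrite tn ?mulr0 ?mul0r // fmM !fmU eq_sym.
Qed.
End Pairing.

Lemma koszul_linear_ext (k : fieldType) (U : vectType k) (S : tensorAlg U -> Prop)
  (S2 : forall s, S s -> s \in gpart (tgrading U) 2%N) :
  koszul S -> linear_ext (qgrading S2).
Proof.
move=> Skoszul P d e et Pproj e_surj ex0 ex n f [fD fZ f0] fd y y2.
pose Pr : projRes S := @ProjRes k U S P d e et Pproj e_surj ex0 ex.
have lin : linear_cocycle (P := Pr) (n := n.+1) f :=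
  ext1_gen_linear (Skoszul Pr n.+1 f (conj (And3 fD fZ f0) fd)).
exact (lin y y2).
Qed.

Section Relations.
Variables (k : fieldType) (Psi : quadCDG k).
Local Notation U := (cdgU Psi).
Local Notation R := (fun t : tensorAlg (cdgU Psi) => t \in cdgR Psi).
Local Notation B := (cdgB Psi).
Local Notation V := (dual (cdgU Psi)).
Local Notation TV := (tensorAlg V).

Lemma cdgR_part s : R s -> s \in gpart (tgrading U) 2%N.
Proof. exact: cdgR_quad. Qed.

Local Notation BA := (quot_alg cdgR_part).
Local Notation GB := (qgrading cdgR_part).

(* The basis of U dual to the chosen basis of V. *)
Definition ubas (a : 'I_(\dim {:V})) : U :=
  \sum_i coord (vbasis {:V}) a (dual_bas i) *: bas i.

Lemma dual_expand (v : V) : v = \sum_i (v (bas i) : k) *: dual_bas i.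
Proof.
apply/lfunP => u; rewrite sum_lfunE [u in LHS](coord_vbasis (memvf u)) linear_sum.
apply: eq_bigr => i _; rewrite linearZ scale_lfunE dual_basE; apply: mulrC.
Qed.

Lemma coord_ubas (v : V) a : coord (vbasis {:V}) a v = v (ubas a).
Proof.
rewrite {1}(dual_expand v) !linear_sum; apply: eq_bigr => i _.
by rewrite !linearZ; apply: mulrC.
Qed.

Lemma ubas_expand (u : U) : u = \sum_a ((bas a : V) u : k) *: ubas a.
Proof.
rewrite {1}(coord_vbasis (memvf u)).
have -> : \sum_a ((bas a : V) u : k) *: ubas a =
    \sum_i (\sum_a (bas a : V) u * coord (vbasis {:V}) a (dual_bas i)) *: bas i.
  under eq_bigr => a _ do rewrite scaler_sumr.
  rewrite exchange_big; apply: eq_bigr => i _; rewrite scaler_suml.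
  by apply: eq_bigr => a _; rewrite scalerA.
apply: eq_bigr => i _; congr (_ *: _).
rewrite -dual_basE {1}(coord_vbasis (memvf (dual_bas i))) sum_lfunE.
by apply: eq_bigr => a _; rewrite scale_lfunE; apply: mulrC.
Qed.

Lemma bas_ubas a b : (bas b : V) (ubas a) = (a == b)%:R.
Proof.
have fr : free (vbasis {:V}) := basis_free (vbasisP _).
by rewrite -coord_ubas /bas coord_free // eq_sym.
Qed.

(** The generators of [B] dual to the letters of [T(V)], whose basis of [V] need not be dual to the
    chosen basis of [U]. *)
Definition xgen a : BA := gen R (ubas a).

Lemma xgen1 a : xgen a \in gpart GB 1%N.
Proof. exact: gen_homog. Qed.

Lemma xgen_sum (c : 'I_(\dim {:V}) -> k) :
  \sum_a c a *: xgen a = gen R (\sum_a c a *: ubas a).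
Proof. by rewrite linear_sum; apply: eq_bigr => a _; rewrite linearZ. Qed.

Lemma xgen_free (c : 'I_(\dim {:V}) -> k) :
  \sum_a c a *: xgen a = 0 -> forall a, c a = 0.
Proof.
move=> c0 a; have /gen_inj c0' : gen R (\sum_a c a *: ubas a) = gen R 0.
  by rewrite -xgen_sum c0 linear0.
have := congr1 (bas a : V) (c0' (@cdgR_quad k Psi)).
rewrite linear0 linear_sum (bigD1 a) //= big1 => [|b ba].
  by rewrite addr0 linearZ /= bas_ubas eqxx [_ *: _]mulr1.
by rewrite linearZ /= bas_ubas (negbTE ba); apply: mulr0.
Qed.

Lemma xgen_gen (b : BA) : b \in gpart GB 1%N ->
  exists c : 'I_(\dim {:V}) -> k, b = \sum_a c a *: xgen a.
Proof.
move=> /(homog1P (@cdgR_quad k Psi)) [u ->]; rewrite {1}(ubas_expand u).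
by exists (fun a => (bas a : V) u); rewrite xgen_sum.
Qed.

Lemma gpart_gen n (b : BA) : b \in gpart GB n.+1 ->
  b \in linspan (fun y : BA =>
    exists u c, [/\ u \in gpart GB 1%N, c \in gpart GB n & y = u * c]).
Proof.
move=> /homogS /asboolP; elim=> [|c _ y [u [a [an ->]]] _ IH]; first exact: rpred0.
apply: rpredD IH; apply: rpredZ; apply: mem_span; exists (gen R u), a; split=> //.
exact: gen_homog.
Qed.

Definition dB : {linear BA -> BA} := cdgd Psi.
Definition hB : BA := cdgh Psi.

Lemma dxgen2 a : dB (xgen a) \in gpart GB 2%N.
Proof. exact: (cdg_deg (cdgP Psi) (xgen1 a)). Qed.

Lemma hB2 : hB \in gpart GB 2%N.
Proof. exact: cdg_curv (cdgP Psi). Qed.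

Lemma dB_xx a b : dB (xgen a * xgen b) = dB (xgen a) * xgen b - xgen a * dB (xgen b).
Proof.
have := cdg_leibniz (cdgP Psi) (xgen b) (xgen1 a); rewrite expr1 mulN1r; exact.
Qed.

Lemma ddB a : dB (dB (xgen a)) = hB * xgen a - xgen a * hB.
Proof.
have := cdg_sq (cdgP Psi) (xgen1 a); rewrite /scomm muln1 expr2 mulrNN !mul1r; exact.
Qed.

Lemma dhB : dB hB = 0.
Proof. exact: cdg_bianchi (cdgP Psi). Qed.
End Relations.

Section Relations.
Variables (k : fieldType) (Psi : quadCDG k).
Local Notation U := (cdgU Psi).
Local Notation R := (fun t : tensorAlg (cdgU Psi) => t \in cdgR Psi).
Local Notation B := (cdgB Psi).
Local Notation V := (dual (cdgU Psi)).
Local Notation TV := (tensorAlg V).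
Local Notation Ann := (annihilator R).
Local Notation S2 := (@cdgR_part k Psi).
Local Notation Psi_rel_at := (rel_at (@xgen k Psi) (dB Psi) (hB Psi)).
Local Notation Psi_rel_coef := (rel_coef (@xgen k Psi) (dB Psi) (hB Psi)).

Lemma Iincl_words (p : {linear B -> k^o}) :
  Iincl p = \sum_a \sum_b (p (xgen a * xgen b : B) : k) *: tword [:: a; b].
Proof.
transitivity (\sum_i \sum_j (p (gen R (bas i) * gen R (bas j)) : k) *:
  (\sum_a \sum_b
    (coord (vbasis {:V}) a (dual_bas i) * coord (vbasis {:V}) b (dual_bas j))
    *: tword [:: a; b])).
  apply: eq_bigr => i _; apply: eq_bigr => j _; congr (_ *: _); rewrite tincl2E.
  by apply: eq_bigr => a _; apply: eq_bigr => b _; rewrite tword2.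
rewrite contract_bilinear; apply: eq_bigr => a _; apply: eq_bigr => b _.
have xE c : xgen c =
    \sum_i coord (vbasis {:V}) c (dual_bas i) *: (gen R (bas i) : quot_alg S2).
  by rewrite /xgen /ubas linear_sum; apply: eq_bigr => i _; rewrite linearZ.
pose pA : {linear quot_alg S2 -> k^o} := p.
have E : pA (xgen a * xgen b) = \sum_i \sum_j
    coord (vbasis {:V}) a (dual_bas i) * coord (vbasis {:V}) b (dual_bas j)
      * pA ((gen R (bas i) : quot_alg S2) * gen R (bas j)).
  exact: etrans (congr2 (fun u v => pA (u * v)) (xE a) (xE b)) (form_mul_sums pA _ _ _).
exact: (congr1 (fun c => c *: tword [:: a; b]) (esym E)).
Qed.

Lemma Arel_words (p : {linear B -> k^o}) :
  Iincl p + tincl (Iphi p) + (p (cdgh Psi) : k) *: 1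
  = \sum_t (p (Psi_rel_coef t) : k) *: tword (rel_word t).
Proof.
refine (etrans _ (esym (rel_index_sum (M := TV) (fun t =>
  (p (Psi_rel_coef t) : k) *: tword (rel_word t))))).
refine (congr2 +%R (congr2 +%R _ _) _).
- exact: Iincl_words.
- by apply: eq_bigr => a _; rewrite coord_ubas IphiE fmu_tincl -tword1.
- by rewrite /= tword_nil.
Qed.

Lemma tword_span (t : TV) : t \in linspan (fun y : TV => exists w, y = tword w).
Proof.
have [N ->] := tcomp_sum t; apply: rpred_sum => n _.
have /tpow_tword /asboolP := tcomp_tpow n t.
elim=> [|c _ y [w [_ ->]] _ IH]; first exact: rpred0.
by rewrite rpredD ?rpredZ //; apply: mem_span; exists w.
Qed.

Lemma form_ideal (t : TV) : t \in ideal (Arel (Psi := Psi)) ->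
  exists N, forall f : {linear TV -> k^o},
    (forall w1 w2, (size w1 + size w2 + 2 <= N)%N ->
      Psi_rel_at (fun w => f (tword w)) w1 w2 = 0) -> f t = 0.
Proof.
pose Q (t : TV) := exists N, forall f : {linear TV -> k^o},
  (forall w1 w2, (size w1 + size w2 + 2 <= N)%N ->
    Psi_rel_at (fun w => f (tword w)) w1 w2 = 0) -> f t = 0.
have Q0 : Q 0 by exists 0%N => f _; rewrite linear0.
have Qlin c y z : Q y -> Q z -> Q (c *: y + z).
  move=> [N Ny] [N' Nz]; exists (maxn N N') => f fN.
  rewrite linearP Ny ?Nz ?scaler0 ?addr0 //.
    by move=> w1 w2 wN; apply: fN; apply: leq_trans wN (leq_maxr _ _).
  by move=> w1 w2 wN; apply: fN; apply: leq_trans wN (leq_maxl _ _).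
move=> /asboolP; elim=> [//|a s b {}t [p ->] _ IH]; rewrite -[_ * b]scale1r.
apply: (Qlin _ _ _ _ IH); rewrite Arel_words.
apply: (span_sandwich Q0 Qlin _ (tword_span a) (tword_span b)).
move=> _ _ [w1 ->] [w2 ->]; exists (size w1 + size w2 + 2)%N => f.
move=> /(_ w1 w2 (leqnn _)) f0.
(* The value of [f] on [w1 s w2] is [p] applied to [rel_at] at [w1], [w2]. *)
rewrite sum_sandwich linear_sum -[RHS](linear0 p) -[X in p X]f0 /rel_at linear_sum.
apply: eq_bigr => t0 _; rewrite !linearZ -!tword_cat catA; apply: mulrC.
Qed.

Lemma Iincl_tpow (p : {linear B -> k^o}) : Iincl p \in tpow V 2%N.
Proof.
rewrite Iincl_words; apply: rpred_sum => a _; apply: rpred_sum => b _.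
by apply: rpredZ; apply: tpowU.
Qed.

Lemma pair2_Iincl (p : {linear B -> k^o}) t : t \in tpow U 2%N ->
  pair2 (Iincl p) t = p (qpi R t).
Proof.
move=> /tpow_tword /asboolP; elim=> [|c _ u [w [w2 ->]] _ IH].
  have := pair2_linr (Iincl p) (-1) 0 0.
  by rewrite scaler0 addr0 mulN1r addNr !linear0 => ->.
rewrite pair2_linr IH !linearP; congr (_ * _ + _).
case: w w2 => [|i [|j []]] // _; rewrite (tword_cat [:: i] [:: j]) !tword1 IinclE.
exact: (congr1 p (esym (qpiM R (tincl (bas i)) (tincl (bas j))))).
Qed.

Lemma Iincl_annihilator (p : {linear B -> k^o}) : Ann (Iincl p).
Proof.
split=> [|t tR]; first exact: Iincl_tpow.
rewrite pair2_Iincl ?cdgR_quad //; have -> : qpi R t = 0; last exact: linear0.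
rewrite -(linear0 (qpi R)); apply/qpiP; rewrite subr0; apply/asboolP.
rewrite -[t]addr0 -[t in t + _]mulr1 -[t in t * _]mul1r.
by constructor=> //; constructor.
Qed.

Lemma tpow2_expand (q : TV) : q \in tpow V 2%N ->
  q = \sum_a \sum_b pair2 q (tincl (ubas a) * tincl (ubas b)) *: tword [:: a; b].
Proof.
move=> /tpow_tword /asboolP; elim=> [|c _ u [w [w2 ->]] _ {1}->].
  by rewrite big1 // => a _; rewrite big1 // => b _; rewrite pair20 scale0r.
case: w w2 => [|i [|j []]] // _.
apply: etrans (esym (sum_delta2 c _ (fun a b => tword [:: a; b]) i j)) _.
apply: eq_bigr => a _; apply: eq_bigr => b _.
refine (congr1 (fun c => c *: tword [:: a; b]) _).
by rewrite pair2_lin (tword_cat [:: i] [:: j]) !tword1 pair2E !bas_ubas.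
Qed.

(** Pairing with [q] is zero outside degree 2 and kills [R], hence kills the ideal of relations of
    [B]: it descends to a form on [B]. *)
Lemma annihilator_Iincl (q : TV) : Ann q -> exists p : {linear B -> k^o}, q = Iincl p.
Proof.
move=> [q2 qR].
have [psi psiE] := @linear_form_exists k (tensorAlg U) (pair2 q) (pair2_linr q).
have psi0 t : t \in ideal R -> psi t = 0.
  move=> /(ideal_homog_span (tgrading U)) /asboolP.
  elim=> [|c _ y [i [a [s [j [b [ai Rs bj ->]]]]]] _ IH].
    exact: linear0.
  rewrite linearP IH addr0; have asb := gpartM (gpartM ai (S2 Rs)) bj.
  have [ij|/(pair2_tpow q asb) e] := eqVneq (i + 2 + j)%N 2%N; last first.
    by rewrite psiE e scaler0.
  have i0 : i = 0%N by case: i ij {ai asb} => [//|i]; rewrite addSn addn2 !addSn.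
  have j0 : j = 0%N by case: j ij {bj asb} => [//|j]; rewrite i0 add0n addnS.
  rewrite i0 in ai; rewrite j0 in bj.
  rewrite (geps_part0 ai) (geps_part0 bj) scalar_sandwich linearZ psiE (qR _ Rs).
  by rewrite /= !scaler0.
have psiW t t' : qpi R t = qpi R t' -> psi t = psi t'.
  by move=> /qpiP /psi0 /eqP; rewrite linearB subr_eq0 => /eqP.
have qE y : qpi R (qrepr y) = y by apply: qreprK.
have [c a b|p pE] := @linear_form_exists k B (fun b => psi (qrepr b)).
  by rewrite -(linearP psi); apply: psiW; rewrite (linearP (qpi R)) /= !qE.
exists p; rewrite (tpow2_expand q2) Iincl_words; apply: eq_bigr => a _.
apply: eq_bigr => b _; refine (congr1 (fun c => c *: tword [:: a; b]) _).
rewrite -psiE pE; apply: psiW.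
by rewrite qE; apply: qpiM.
Qed.

Hypothesis Rkoszul : koszul R.

Lemma extend_top_word n (F : seq 'I_(\dim {:V}) -> k) N :
  kills_relations (@xgen k Psi) F ->
  exists F', [/\ forall w, size w = n -> F' w = F w,
    forall w, (size w < n)%N -> F' w = 0
    & forall w1 w2, (size w1 + size w2 + 2 <= N)%N -> Psi_rel_at F' w1 w2 = 0].
Proof.
apply: (extend_top (@xgen1 k Psi) (@dxgen2 k Psi) (hB2 Psi) (@dB_xx k Psi)
  (@ddB k Psi) (dhB Psi)).
move=> m f; apply: (quadratic_cycle_boundary (@gpart_gen k Psi) (@xgen1 k Psi)
  (@xgen_free k Psi) (@xgen_gen k Psi)).
exact: koszul_linear_ext.
Qed.

Lemma Ann2 q : Ann q -> q \in gpart (tgrading V) 2%N.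
Proof. by case. Qed.

(** Otherwise a form [f] with value 1 on the leading part of [t] vanishes on the ideal of [B^!].
    Extended upwards to [f'], it kills [t]; but [f'] is zero below degree [n], so its value at [t]
    is 1. *)
Lemma ideal_top n (t : TV) : t \in ideal (Arel (Psi := Psi)) ->
  deg_le (tgrading V) n t -> gproj (tgrading V) n t \in ideal Ann.
Proof.
move=> tI tn; apply: contrapT => /negP /separating_form[f [f0 /eqP f1]].
have fK : kills_relations (@xgen k Psi) (fun w => f (tword w)).
  move=> w1 w2; apply: linear_forms_eq => p; rewrite linear0.
  have <- : f (tword w1 * Iincl p * tword w2) = 0.
    by apply: f0; apply/asboolP; rewrite -[_ * tword w2]addr0;
      apply: in_idealD (in_ideal0 _); apply: Iincl_annihilator.
  have IE := etrans (Iincl_words p) (pair_bigA _ (fun a b =>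
    (p (xgen a * xgen b : B) : k) *: tword [:: a; b])).
  rewrite IE sum_sandwich [in RHS]linear_sum pair_bigA linear_sum.
  apply: eq_bigr => -[a b] _ /=; rewrite !linearZ -!tword_cat -catA; apply: mulrC.
have [N NI] := form_ideal tI.
have [F' [F'F F'0 F'rel]] := extend_top_word n N fK.
have [f' f'E] := form_of_words F'.
have f't : f' t = 0.
  by apply: NI => w1 w2 /F'rel <-; apply: eq_bigr => s _; rewrite f'E.
have f'top : f' (tcomp n t) = f (tcomp n t).
  by apply: tpow_form_eq (tcomp_tpow n t) => w wn; rewrite f'E F'F.
suff f't0 : f' (t - tcomp n t) = 0.
  move/eqP: f1; rewrite -[f _]/(f (tcomp n t)) -f'top => f1.
  by move: f't0; rewrite linearB f't f1 sub0r => /eqP; rewrite oppr_eq0 oner_eq0.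
case: n tn fK F'F F'0 {f1 f'top} => [|n] tn _ _ F'0.
  by rewrite -[tcomp 0 t]/(gproj (tgrading V) 0 t) (deg_le0 tn) subrr linear0.
apply/eqP; apply: (@deg_le_span _ _ (tgrading V) (ker f') n); last exact: deg_le_top.
move=> i i_n u /tpow_tword /asboolP; elim=> [|c _ v [w [wi ->]] _ IH].
  exact: rpred0.
by apply: rpredD IH; apply: rpredZ; rewrite unfold_in f'E F'0 ?wi.
Qed.
End Relations.

(** * The associated graded algebra *)

Section AssociatedGraded.
Variables (k : fieldType) (Psi : quadCDG k).
Local Notation U := (cdgU Psi).
Local Notation R := (fun t : tensorAlg (cdgU Psi) => t \in cdgR Psi).
Local Notation V := (dual (cdgU Psi)).
Local Notation TV := (tensorAlg V).
Local Notation Ann := (annihilator R).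
Local Notation Rel := (Arel (Psi := Psi)).
Local Notation W := (@inW k Psi).
Local Notation GT := (tgrading V).
Local Notation gr := (gr W).

Lemma inW1 : W 1.
Proof. by exists 1, 0; rewrite linear0 addr0 scale1r. Qed.

Lemma inW_gen v : W (gen Rel v).
Proof. by exists 0, v; rewrite scale0r add0r. Qed.

(** Short words are padded with factors [1], which lies in [W]. *)
Lemma word_prod n w : (size w <= n)%N -> is_prod W n (qpi Rel (tword w)).
Proof.
elim: n w => [|n IH] [|a w] wn; [by rewrite tword_nil | by [] | |].
  exists 1, 1; split; [exact: inW1 | | by rewrite mulr1 tword_nil].
  by rewrite -[1]/(qpi Rel 1) -tword_nil; apply: IH.
exists (qpi Rel (tword [:: a])), (qpi Rel (tword w)); split.
- by rewrite tword1; apply: inW_gen.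
- exact: IH.
- by rewrite (tword_cat [:: a] w) qpiM.
Qed.

Lemma deg_le_Fil n (t : TV) : deg_le GT n t -> qpi Rel t \in Fil W n.
Proof.
apply: (@deg_le_span _ _ GT (preim_sub (qpi Rel) (Fil W n))) => i i_n u.
move=> /tpow_tword /asboolP; elim=> [|c _ v [w [wi ->]] _ IH]; first exact: rpred0.
apply: rpredD IH; apply: rpredZ; rewrite -[_ \in _]/(qpi Rel (tword w) \in Fil W n).
by apply: mem_span; apply: word_prod; rewrite wi.
Qed.

Lemma Fil_deg_le n a : a \in Fil W n -> exists t, deg_le GT n t /\ a = qpi Rel t.
Proof.
have deg0 m : deg_le GT m 0 by move=> i _; apply: linear0.
move=> /asboolP; elim=> [|c s _ sP _ [t [tn ->]]].
  by exists 0; rewrite linear0.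
suff [u [un ->]] : exists u, deg_le GT n u /\ s = qpi Rel u.
  by exists (c *: u + t); rewrite linearP; split=> //; apply: deg_le_lin.
elim: n s sP {t tn} => [|n IH] s /=.
  move=> ->; exists 1; split=> //.
  by apply: (@part_deg_le _ _ GT 0) => //; apply: tpow1.
move=> [_ [y [[c' [v ->]] /IH [u [un ->]] ->]]].
exists ((c' *: 1 + tincl v) * u); split; last by rewrite qpiM linearP.
rewrite -add1n; apply: deg_leM un; apply: deg_le_lin.
  by apply: (@part_deg_le _ _ GT 0) => //; apply: tpow1.
by apply: (@part_deg_le _ _ GT 1) => //; apply: tincl_tpow.
Qed.

Lemma ideal_low_Fil n (y : TV) :
  y \in ideal Ann -> inLowFil W n (qpi Rel (gproj GT n y)).
Proof.
move=> /(ideal_homog_span GT) /asboolP.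
elim=> [|c _ z [i [a [s [j [b [ai sA bj ->]]]]]] _ IH].
  by rewrite !linear0 inLowFil0.
rewrite !linearP; apply: inLowFil_lin IH.
have asb := gpartM (gpartM ai (Ann2 sA)) bj.
have [<-|/(gproj_neq asb) ->] := eqVneq (i + 2 + j)%N n; last first.
  by rewrite linear0 inLowFil0.
rewrite (gproj_id asb); have [p pE] := annihilator_Iincl sA.
pose low : TV := tincl (Iphi p) + (p (cdgh Psi) : k) *: 1.
have low1 : deg_le GT 1 low.
  rewrite /low addrC; apply: deg_le_lin.
    by apply: (@part_deg_le _ _ GT 0) => //; apply: tpow1.
  by apply: (@part_deg_le _ _ GT 1) => //; apply: tincl_tpow.
(* Modulo the defining relation given by [p], the quadratic element [s] equals [- low]. *)
have asbE : qpi Rel (a * s * b) = qpi Rel (- (a * low * b)).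
  apply/qpiP; rewrite opprK -mulrDl -mulrDr; apply/asboolP.
  rewrite -[X in in_ideal _ X]addr0; apply: in_idealD; last exact: in_ideal0.
  by exists p; rewrite pE addrA.
have lowF : qpi Rel (a * low * b) \in Fil W (i + j).+1.
  apply: deg_le_Fil; rewrite -[(i + j).+1]addn1 addnAC.
  apply: deg_leM (part_deg_le bj (leqnn _)).
  by apply: deg_leM low1; apply: part_deg_le ai (leqnn _).
rewrite -[X in inLowFil _ _ X]/(qpi Rel (a * s * b)) asbE addnAC addn2 /=.
by rewrite linearN rpredN.
Qed.

Hypothesis Rkoszul : koszul R.

(** A representative [u] of degree less than [n] has the same class as [t], so [t - u] lies in the
    inhomogeneous ideal and has the leading part of [t]. *)
Lemma top_low n (t : TV) : deg_le GT n t -> inLowFil W n (qpi Rel t) ->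
  gproj GT n t \in ideal Ann.
Proof.
case: n => [|n] tn /=.
  move=> /eqP t0; apply: ideal_top => //.
  by rewrite -[t]subr0; apply/qpiP; rewrite linear0.
move=> /Fil_deg_le[u [un tu]].
have tuI : t - u \in ideal Rel by apply/qpiP.
have un' := deg_leW un (leqnSn n).
have := ideal_top Rkoszul tuI (deg_leB tn un').
by rewrite linearB /= [X in _ - X]un // subr0.
Qed.

Lemma gr_rep n (u : gr n) : exists t (tF : qpi Rel t \in Fil W n),
  deg_le GT n t /\ u = grpi tF.
Proof.
have [a [aF ->]] := grpi_surj u; have [t [tn aE]] := Fil_deg_le aF.
by move: aF; rewrite aE => aF; exists t, aF.
Qed.

(** The inverse of the surjection from [B^!]: independence of the representative is [top_low],
    injectivity is [ideal_low_Fil]. *)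
Definition symbol_val n (u : gr n) : quotalg Ann :=
  qpi Ann (gproj GT n (projT1 (cid (gr_rep u)))).

Lemma symbol_homog n (u : gr n) : symbol_val u \in homog Ann n.
Proof.
apply/homogP; exists (gproj GT n (projT1 (cid (gr_rep u)))) => //.
exact: (gproj_part GT n).
Qed.

Definition symbol n (u : gr n) : hcomp Ann n :=
  Subspace (symbol_val u) (symbol_homog u).

Lemma symbolE n t (tF : qpi Rel t \in Fil W n) : deg_le GT n t ->
  subspace_val (symbol (grpi tF)) = qpi Ann (gproj GT n t).
Proof.
move=> tn; rewrite [LHS]/= /symbol_val; case: cid => u /= [uF [un /grpiP]].
rewrite -linearB => /(top_low (deg_leB tn un)); rewrite linearB => tu.
by apply/esym/qpiP.
Qed.

Lemma symbol_linear n : linear (@symbol n).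
Proof.
move=> c u v; apply: subspace_inj; rewrite subspace_val_lin.
have [s [sF [sn ->]]] := gr_rep u; have [t [tF [tn ->]]] := gr_rep v.
have stn := deg_le_lin c sn tn; have stF := deg_le_Fil stn.
have stF' : c *: qpi Rel s + qpi Rel t \in Fil W n by rewrite -linearP.
have -> : c *: grpi sF + grpi tF = grpi stF.
  rewrite -(grpi_lin sF tF stF'); apply/grpiP.
  by rewrite linearP subrr inLowFil0.
by rewrite !symbolE // !linearP.
Qed.

Lemma symbol_inj n : injective (@symbol n).
Proof.
move=> u v; have [s [sF [sn ->]]] := gr_rep u; have [t [tF [tn ->]]] := gr_rep v.
move=> /(congr1 (@subspace_val _ _ _)); rewrite !symbolE // => /qpiP.
rewrite -linearB => stI; apply/grpiP; rewrite -linearB.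
have stn := deg_leB sn tn; have := ideal_low_Fil n stI.
rewrite (gproj_id (gproj_part GT n _)).
case: n => [|n] in u v s sF sn t tF tn stI stn *.
  by rewrite (deg_le0 stn).
move=> /= topF; rewrite -[s - t](subrK (gproj GT n.+1 (s - t))) linearD rpredD //.
exact: deg_le_Fil (deg_le_top stn).
Qed.

Lemma symbol_surj n (v : hcomp Ann n) : exists u, symbol u = v.
Proof.
case: v => b bn; have /homogP[t tn bE] := bn.
have tle := @part_deg_le _ _ GT _ _ _ tn (leqnn n).
exists (grpi (deg_le_Fil tle)); apply: subspace_inj; rewrite symbolE //.
by rewrite (gproj_id (g := GT) tn) -bE.
Qed.

Lemma symbolM i j (u : gr i) (v : gr j) :
  symbol (grMul u v) = hMul (symbol u) (symbol v).
Proof.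
have [s [sF [sn ->]]] := gr_rep u; have [t [tF [tn ->]]] := gr_rep v.
have stn := deg_leM sn tn; have stF := deg_le_Fil stn.
apply: subspace_inj; rewrite hMulE grMulE.
have -> : grpi (FilM sF tF) = grpi stF.
  by apply/grpiP; rewrite qpiM subrr inLowFil0.
by rewrite !symbolE // (gproj_top_M sn tn) qpiM.
Qed.

Lemma symbol1 : symbol (grOne W) = hOne Ann.
Proof.
have one0 : deg_le GT 0 1 by apply: (@part_deg_le _ _ GT 0) => //; apply: tpow1.
apply: subspace_inj; have -> : grOne W = grpi (deg_le_Fil one0).
  by apply/grpiP; rewrite subrr inLowFil0.
by rewrite symbolE // (deg_le0 one0).
Qed.
End AssociatedGraded.

Theorem theorem3p3 (k : fieldType) (Psi : quadCDG k) :
  koszul (fun t => t \in cdgR Psi) ->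
  gradedIso (GrA Psi) (quadDual (fun t => t \in cdgR Psi)).
Proof.
move=> Rkoszul.
have ex n := linear_map_exists (@symbol_linear k Psi Rkoszul n).
pose f n := projT1 (cid (ex n)).
have fE n u : f n u = symbol u by rewrite /f; case: cid.
exists f; split=> [n||i j u v].
- apply: inj_surj_bij => [u v|v]; first by rewrite !fE => /(symbol_inj Rkoszul).
  by have [u <-] := symbol_surj Rkoszul v; exists u; rewrite fE.
- by rewrite fE; apply: symbol1.
- by rewrite !fE; apply: symbolM.
Qed.
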